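(* Let $B=(V,E,\le)$ be a simple, properly ordered Bratteli diagram (with $X_B$ a Cantor set) which is coloured, i.e. for all $n\ge1$ and all $\ell$ integers $1<M_\ell(n)<r_\ell(n)-2$ are fixed, and suppose that: (a) for each $n\ge1$, $v_0(n)$ is the unique source of the minimal edges starting in $V_n$; (b) for $n\ge2$, each vertex in $V_n$ is the range of at least $5$ edges; (c) for $n\ge2$, $v_0(n)$ is connected to each $v\in V_{n-1}$ through at least $4$ edges; (d) for all $n\in\mathbb N$, each $\gamma\in X_B$ whose $n$-head is quite small and each $k\ge1$, $\frac1k\,|\{i=0,\ldots,k-1\colon(\phi_B^i(\gamma))_n\text{ is not thick}\}|<3^{-n}$; (e) for $n\ge2$, if $\alpha\in X_B$ crosses a thin interval in $E_n$ before $t>0$, then $\frac1{t+1}\sum_{i=0}^t\mathbf 1_{C^{**}_{n-1}}(\phi_B^i(\alpha))<1/2$. Let $\hat B$ be the diagram obtained by copy-pasting $B$ as follows: (i) for each $n\ge1$, $\hat V_n$ contains three copies $v_\ell^0(n),v_\ell^1(n),v_\ell^2(n)$ of each $v_\ell(n)\in V_n$ and, only for $\ell=0$, a fourth copy $v_0^3(n)$ of $v_0(n)$; (ii) for each $n\ge1$ and all $j,\ell$, $s(e^j_{\ell,0}(n))=v_0^3(n)$ and $s(e^j_{\ell,r_\ell(n)-1}(n))=v^0_{\ell_+}(n)$, where $\ell_+=\ell_+(\ell,n)$ is such that $v_{\ell_+}(n)=s(e_{\ell,r_\ell(n)-1}(n))$ in $B$; (iii) for each $n\ge1$ and $m=1,\ldots,r_0(n)-2$,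 if $s(e_{0,m}(n))=v_\ell(n)$ in $B$, then $s(e^3_{0,m}(n))=v_\ell^j(n)$, where $j\in\{0,1,2\}$ satisfies $j=|\{k=0,\ldots,m-1\colon s(e_{0,k}(n))=v_\ell(n)\}|\bmod 3$; (iv) for each $n\ge1$ and each $\ell$: if $1\le m\le M_\ell(n)$ and $s(e_{\ell,m}(n))=v_{\ell'}(n)$ in $B$, then $s(e^j_{\ell,m}(n))=v^j_{\ell'}(n)$ for $j=0,1,2$; if $M_\ell(n)+1\le m\le r_\ell(n)-2$ and $s(e_{\ell,m}(n))=v_{\ell'}(n)$ in $B$, then $s(e^0_{\ell,m}(n))=s(e^1_{\ell,m}(n))=v^0_{\ell'}(n)$ and $s(e^2_{\ell,m}(n))=v^1_{\ell'}(n)$. Let $(B,\hat B,\pi)$ be the corresponding extension triple. Then $(X_{\hat B},\phi_{\hat B})$ is an almost $1$-to-$1$ extension of $(X_B,\phi_B)$ (via $\pi$) all of whose fibres have at most $3$ elements, $0$ is isolated in $S_D$, and $S_D\ne\{0\}$. In particular, $S_D$ is not an interval. Further, if $(X_B,\phi_B)$ is $k$-expansive, then so is $(X_{\hat B},\phi_{\hat B})$.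
   Context: **Bratteli diagrams.** A Bratteli diagram $B=(V,E)$ is an infinite graph with vertices $V=\bigsqcup_{n\ge0}V_n$, $V_0=\{v_0\}$, $1\le|V_n|<\infty$, edges $E=\bigsqcup_{n\ge0}E_n$, $1\le|E_n|<\infty$, and range and source maps $r,s\colon E\to V$ with $r(E_n)=V_{n+1}$, $s(E_n)=V_n$. A path is a (finite or infinite) sequence of edges $(e_0,e_1,\ldots)$ with $r(e_{i-1})=s(e_i)$. $E_{n,N}$ is the set of finite paths from $V_n$ to $V_N$. $X_B$ is the set of infinite paths $(\alpha_0,\alpha_1,\ldots)$ ($\alpha_n\in E_n$) starting in $v_0$; the $n$-head of such a path is $(\alpha_0,\ldots,\alpha_n)$; $X_B$ carries the topology generated by the cylinders $[e_0,\ldots,e_n]$ (all paths in $X_B$ with $n$-head $(e_0,\ldots,e_n)$). Telescoping $B$ along $0=n_0<n_1<\cdots$ gives the diagram with vertex sets $V_{n_k}$ and edge sets $E_{n_k,n_{k+1}}$. $B$ is simple if it can be telescoped to a diagram in which each vertex of each level is connected by an edge to each vertex of the next level. **Orders.** $B$ is ordered if $E$ carries a partial order in which $e,e'$ are comparable iff $r(e)=r(e')$. This extends to finite paths starting on the same level and ending in the same vertex, and to infinite paths which eventually agree, by comparing the edges on the last level where the paths differ. A path is maximal (minimal) if all its edges are. $B$ is properly ordered if $X_B$ has a unique maximal path $\gamma^+$ and a unique minimal path $\gamma^-$. The Vershik map $\phi_B\colon X_B\to X_B$ sends each non-maximal path to its successor and $\gamma^+$ to $\gamma^-$; it is a homeomorphism.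 **Copy-pasting and extension triples.** Write $V_n=\{v_0(n),\ldots,v_{|V_n|-1}(n)\}$, let $r_\ell(n)$ be the number of $e\in E_n$ with range $v_\ell(n+1)$, and let $e_{\ell,0}(n)<e_{\ell,1}(n)<\cdots<e_{\ell,r_\ell(n)-1}(n)$ be these edges. $\hat B=(\hat V,\hat E,\hat\le)$ is obtained by copy-pasting $B$ if (possibly after relabelling) $\hat V_0=\{v_0\}$ and: for $n\ge1$ there are $j_\ell(n)\in\mathbb N$ with $\hat V_n=\{v_\ell^j(n)\colon 0\le\ell<|V_n|,\ 0\le j<j_\ell(n)\}$ ($v_\ell^j(n)$ are the copies of $v_\ell(n)$); for $n\ge0$, $\hat E_n=\{e_{\ell,m}^j(n)\colon 0\le\ell<|V_{n+1}|,\ 0\le m<r_\ell(n),\ 0\le j<j_\ell(n+1)\}$ with $r(e_{\ell,m}^j(n))=v_\ell^j(n+1)$; for $n\ge1$, if $s(e_{\ell,m}(n))=v_{\ell'}(n)$ in $B$, then $s(e_{\ell,m}^j(n))=v_{\ell'}^{j'}(n)$ for some $j'$; and $e_{\ell,m}^j(n)\,\hat<\,e_{\ell',m'}^{j'}(n')$ iff $j=j'$ and $e_{\ell,m}(n)<e_{\ell',m'}(n')$ in $B$. The collapsing map is $\pi\colon X_{\hat B}\to X_B$, $(e_{\ell_n,m_n}^{j_n}(n))_{n\ge0}\mapsto(e_{\ell_n,m_n}(n))_{n\ge0}$, and $(B,\hat B,\pi)$ is called an extension triple. $\pi$ is almost $1$-to-$1$ if it is a factor map (continuous surjection with $\pi\circ\phi_{\hat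 B}=\phi_B\circ\pi$) with at least one singleton fibre. **Colouring.** Given integers $1<M_\ell(n)<r_\ell(n)-2$ for $n\ge1$ and $0\le\ell<|V_{n+1}|$, the edge $e_{\ell,m}(n)$ ($n\ge1$) is thick if $1\le m\le M_\ell(n)$ and thin if $M_\ell(n)+1\le m\le r_\ell(n)-2$. An edge is extremal if it is minimal or maximal. For $n\ge1$, $C^*_n$ is the union of all $n$-cylinders $[\alpha_0,\ldots,\alpha_n]$ such that, for some $i\in\{1,\ldots,n\}$, $\alpha_i$ is thin or extremal; $C^{**}_n$ is the union of $C^*_n$ with all cylinders $[\alpha_0,\ldots,\alpha_{n+1}]$ where $\alpha_{n+1}$ is extremal. A path $\alpha\in X_B$ crosses a thin interval in $E_n$ before $t>0$ if, for some $\ell$, $e_{\ell,0}(n)<\alpha_n\le e_{\ell,M_\ell(n)}(n)$ and $(\phi_B^{t'}\alpha)_n=e_{\ell,r_\ell(n)-1}(n)$ for some $t'\in\{1,\ldots,t\}$. For $n\ge1$, a finite path $(\gamma_0,\ldots,\gamma_n)\in E_{0,n+1}$ is quite small if $\gamma_i=e_{0,0}(i)$ for $i=0,\ldots,n-2$, $\gamma_{n-1}=e_{\ell_{n-1},0}(n-1)$ and $\gamma_n=e_{\ell_n,1}(n)$ for some $\ell_{n-1},\ell_n$. **Birkhoff spectrum.** $D=\{\alpha\in X_B\colon \exists\,\beta,\beta'\in\pi^{-1}\alpha\text{ with }\beta_0\ne\beta'_0\}$, $S_D^n(\alpha)=\frac1n\sum_{i=0}^{n-1}\mathbf 1_D(\phi_B^i\alpha)$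 and $S_D=\bigcup_{\alpha\in X_B}\bigcap_{N\in\mathbb N}\overline{\{S_D^n(\alpha)\colon n\ge N\}}$. **$k$-expansive.** $(X_B,\phi_B)$ is $k$-expansive if for all $\gamma\ne\gamma'$ in $X_B$ there is $n\in\mathbb Z$ such that the $k$-heads of $\phi_B^n(\gamma)$ and $\phi_B^n(\gamma')$ differ. *)

(* Defs.v *)
(* MathComp / MathComp-Analysis *)
From HB Require Import structures.
From mathcomp Require Import all_boot all_order all_algebra.
From mathcomp Require Import all_classical all_reals all_analysis.

Set Implicit Arguments.
Unset Strict Implicit.
Unset Printing Implicit Defensive.

Import Order.TTheory GRing.Theory Num.Theory.
Import numFieldNormedType.Exports.

Local Open Scope classical_set_scope.

(* Raw data of an ordered diagram; the axioms are in [ordered_bratteli], so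
   that [copy_paste] below needs no proof to be defined. *)
Record diagram := Diagram {
  vtx : nat -> finType;
  edg : nat -> finType;
  src : forall n, edg n -> vtx n;
  rng : forall n, edg n -> vtx n.+1;
  ele : forall n, rel (edg n) }.

Arguments src {_ n} _.
Arguments rng {_ n} _.
Arguments ele {_ n} _ _.

Section Diagram.
Variable B : diagram.

(* The sets [edg B n] are nonempty as a consequence of the first two axioms. *)
Definition bratteli : Prop :=
  [/\ #|vtx B 0| = 1,
      forall n (v : vtx B n), exists e : edg B n, src e = v &
      forall n (v : vtx B n.+1), exists e : edg B n, rng e = v].

Definition edge_order : Prop := forall n,
  [/\ reflexive (@ele B n), antisymmetric (@ele B n), transitive (@ele B n) &
      forall e e' : edg B n, ele e e' || ele e' e = (rng e == rng e')].

Definition ordered_bratteli : Prop := bratteli /\ edge_order.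

(* [joined v w]: some path in E_{n,N} starts in v and ends in w. *)
Inductive joined n (v : vtx B n) : forall N, vtx B N -> Prop :=
| joined_edge (e : edg B n) : src e = v -> joined v (rng e)
| joined_rcons N (e : edg B N) : joined v (src e) -> joined v (rng e).

(* The telescoping of B along [nk] has vertex sets V_{nk k} and edge sets
   E_{nk k, nk (k+1)}. *)
Definition simple : Prop := exists nk : nat -> nat,
  [/\ nk 0 = 0, forall k, nk k < nk k.+1 &
      forall k (v : vtx B (nk k)) (w : vtx B (nk k.+1)), joined v w].

Definition elt n (e e' : edg B n) : bool := (e != e') && ele e e'.

Definition emin n (e : edg B n) : bool := [forall e', ~~ elt e' e].
Definition emax n (e : edg B n) : bool := [forall e', ~~ elt e e'].
Definition extremal n (e : edg B n) : bool := emin e || emax e.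

(* The label l of v_l(n) is the vertex itself.  As edges are comparable only if
   they have the same range, [erank e] is the m for which e = e_{l,m}(n), where
   v_l(n+1) = rng e. *)
Definition erank n (e : edg B n) : nat := #|[set e' | elt e' e]%SET|.
Definition nedges n (v : vtx B n.+1) : nat := #|[set e | rng e == v]%SET|.

(* X_B; every such path starts in v_0, as V_0 = {v_0}. *)
Record XB := Path {
  path_edge :> forall n, edg B n;
  path_edgeP : forall n, src (path_edge n.+1) = rng (path_edge n) }.

HB.instance Definition _ := gen_eqMixin XB.
HB.instance Definition _ := gen_choiceMixin XB.

Definition same_head n (a b : XB) : Prop := forall i, i <= n -> a i = b i.
Definition cylinder n (a : XB) : set XB := [set b | same_head n a b].
Definition cylinders : set (set XB) :=
  [set C | exists n a, C = cylinder n a].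

HB.instance Definition _ := @isSubBaseTopological.Build XB _ cylinders id.

Definition plt (a b : XB) : Prop :=
  exists n, elt (a n) (b n) /\ forall i, n < i -> a i = b i.

Definition pmin (a : XB) : Prop := forall n, emin (a n).
Definition pmax (a : XB) : Prop := forall n, emax (a n).

Definition properly_ordered : Prop :=
  (exists! a, pmax a) /\ (exists! a, pmin a).

Definition successor (a b : XB) : Prop :=
  plt a b /\ ~ exists c, plt a c /\ plt c b.

(* The default value of [xget] is never used if B is properly ordered. *)
Definition vershik (a : XB) : XB :=
  if `[< pmax a >] then xget a [set b | pmin b]
  else xget a [set b | successor a b].

Definition vershik_inv (a : XB) : XB := xget a [set b | vershik b = a].

Definition vershik_iter (z : int) : XB -> XB :=
  match z with
  | Posz n => iter n vershik
  | Negz n => iter n.+1 vershik_inv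
  end.

Definition expansive k : Prop := forall a b : XB, a <> b ->
  exists z : int, ~ same_head k (vershik_iter z a) (vershik_iter z b).

Definition cantor_set : Prop :=
  exists (f : XB -> cantor_space) (g : cantor_space -> XB),
    [/\ cancel f g, cancel g f, continuous f & continuous g].

Section Colouring.
Variable M : forall n, vtx B n.+1 -> nat.

Definition coloured : Prop :=
  forall n (l : vtx B n.+1), 1 <= n -> 1 < M l /\ M l + 2 < nedges l.

(* Used at the levels n >= 1 only. *)
Definition thick n (e : edg B n) : bool := 1 <= erank e <= M (rng e).
Definition thin n (e : edg B n) : bool :=
  M (rng e) + 1 <= erank e <= nedges (rng e) - 2.

Definition Cstar n : set XB :=
  \bigcup_(a in [set a : XB | exists i, 1 <= i <= n /\
                                (thin (a i) \/ extremal (a i))])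
    cylinder n a.

Definition Cstarstar n : set XB :=
  Cstar n `|` \bigcup_(a in [set a : XB | extremal (a n.+1)]) cylinder n.+1 a.

Definition crosses_thin n t (a : XB) : Prop := exists l : vtx B n.+1,
  (rng (a n) = l /\ 0 < erank (a n) <= M l) /\
  exists t', 1 <= t' <= t /\
    rng (iter t' vershik a n) = l /\ emax (iter t' vershik a n).

End Colouring.

(* The n-head of [a] is quite small, for n >= 1; [v0 n] is the vertex v_0(n). *)
Definition quite_small (v0 : forall n, vtx B n) n (a : XB) : Prop :=
  [/\ forall i, i + 2 <= n -> rng (a i) = v0 i.+1 /\ erank (a i) = 0,
      erank (a n.-1) = 0 &
      erank (a n) = 1].

End Diagram.

Arguments elt {B n} e e'.
Arguments emin {B n} e.
Arguments emax {B n} e.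
Arguments extremal {B n} e.
Arguments erank {B n} e.
Arguments nedges {B n} v.
Arguments thick {B} M {n} e.
Arguments thin {B} M {n} e.
Arguments coloured {B} M.
Arguments expansive : clear implicits.
Arguments vershik {B} _.

(* [ncopies v] is j_l(n) for v = v_l(n); the edge e_{l,m}^j(n) has the source
   v_{l'}^{j'}(n), j' = [attach e j], for e = e_{l,m}(n) and v_{l'}(n) = src e. *)
Record copying (B : diagram) := Copying {
  ncopies : forall n, vtx B n -> nat;
  ncopies0 : forall v : vtx B 0, ncopies v = 1;
  attach : forall n (e : edg B n), 'I_(ncopies (rng e)) -> 'I_(ncopies (src e)) }.

Arguments ncopies {B} c {n} v.
Arguments attach {B c n e} j.

Section CopyPaste.
Variables (B : diagram) (c : copying B).

Definition copy_vtx n : finType := {v : vtx B n & 'I_(ncopies c v)}.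
Definition copy_edg n : finType := {e : edg B n & 'I_(ncopies c (rng e))}.
Definition copy_src n (x : copy_edg n) : copy_vtx n :=
  Tagged (fun v : vtx B n => 'I_(ncopies c v)) (attach (tagged x)).
Definition copy_rng n (x : copy_edg n) : copy_vtx n.+1 :=
  Tagged (fun v : vtx B n.+1 => 'I_(ncopies c v)) (tagged x).
Definition copy_ele n : rel (copy_edg n) := fun x y =>
  (tagged x == tagged y :> nat) && ele (tag x) (tag y).

Definition copy_paste : diagram :=
  @Diagram copy_vtx copy_edg copy_src copy_rng copy_ele.

Definition collapse (b : XB copy_paste) : XB B :=
  @Path B (fun n => tag (b n : copy_edg n))
          (fun n => congr1 (@tag _ _) (path_edgeP b n)).

Definition factor_map (p : XB copy_paste -> XB B) : Prop :=
  [/\ continuous p, set_surj setT setT p &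
      forall b, p (vershik b) = vershik (p b)].

Definition almost_1to1 (p : XB copy_paste -> XB B) : Prop :=
  factor_map p /\ exists a b, p @^-1` [set a] = [set b].

Definition Dset : set (XB B) :=
  [set a | exists b b' : XB copy_paste,
     [/\ collapse b = a, collapse b' = a & b 0 <> b' 0]].

Definition birkhoff_mean (R : realType) n (a : XB B) : R :=
  (n%:R^-1 * \sum_(0 <= i < n) \1_Dset (iter i vershik a))%R.

Definition birkhoff_spectrum (R : realType) : set R :=
  \bigcup_(a in setT) \bigcap_(N in setT)
    closure [set birkhoff_mean R n a | n in [set n | N <= n]].

End CopyPaste.

Arguments collapse {B} c b.
Arguments birkhoff_spectrum {B} c R.

(* Main.v *)
Require Import Defs.
From mathcomp Require Import all_boot all_order all_algebra.
From mathcomp Require Import all_classical all_reals all_analysis.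
From mathcomp Require Import zify finmap.

Import Order.TTheory GRing.Theory Num.Theory.
Import numFieldNormedType.Exports.

Set Implicit Arguments.
Unset Strict Implicit.
Unset Printing Implicit Defensive.

Local Open Scope classical_set_scope.

(** A path of the copied diagram lying over a given path [a] of [B] is a
    sequence of copy indices [j n], where [j n] is obtained from [j n.+1] by a
    map [att] attached to the edge [a n.+1]: constant if the edge is extremal,
    the identity on the indices at most 2 if it is thick, and 0,1,2 |-> 0,0,1 if
    it is thin.  A nonextremal edge sends every index to one at most 2, and two
    thin edges together merge the indices 0, 1 and 2.  Hence two lifts of [a]
    that differ at level [n] force all later edges of [a] to be nonextremal, with
    at most one of them thin.  From this the fibres have at most three elements,
    and the path is in D exactly when no edge beyond level 0 is extremal and at
    most one is thin ([DsetP]).  Paths with infinitely many extremal edges, such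
    as the minimal one, have a single lift.  Lifts exist because starting from
    the index 0 at a far level gives values that stabilise: 0 is fixed by thick
    and thin edges and forgotten by extremal ones.

    For the spectrum, all that matters is a uniform lower bound for the
    frequency of visits to D along the orbit of a path [a] in D
    ([one_thin_freq]).  Such an [a] is eventually thick.  Given a large time [t],
    let [n] be the last level where [a] has crossed a thin interval before [t].
    By (e), more than half of the times up to [t] show thick edges at the levels
    1, ..., n-1 and a nonextremal one at level [n].  Level [n+1] has not been
    crossed, so its edge stays nonextremal, and above it nothing has moved.  So
    a visit to D can fail at one of these times only if the edges at the levels
    [n] and [n+1] are both thin.  Such times can only come after the first moment
    when level [n+1] is thin and level [n] has left its minimal edge; at that
    moment the [n]-head is quite small, so by (d) level [n] is not thick for a
    proportion less than 3^-n <= 1/9 of the time from then on.  At least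
    1/2 - 1/9 of the times up to [t] are therefore visits to D.

    Consequently an orbit that meets D has all limit points of its Birkhoff
    means bounded away from 0, and an orbit that misses D has all means equal to
    0.  The orbit of the minimal path is of the second kind and, by compactness,
    there is a path with only thick edges beyond level 0, which is of the first
    kind.  So 0 is an isolated but not the only point of the spectrum.

    For expansiveness, two lifts of the same path that differ at level [n] are
    moved, by the same power of the Vershik map, over a path whose edges at the
    levels 1, ..., n are thick; these transport the difference at level [n] to
    level 0. *)

Lemma XB_ext (B : diagram) (a b : XB B) : (forall n, a n = b n) -> a = b.
Proof.
case: a b => [a Ha] [b Hb] /= eab.
have {}eab : a = b by exact: functional_extensionality_dep.
by case: _ / eab Hb => Hb; congr Path; apply: Prop_irrelevance.
Qed.

(** * Ranks of edges *)

Section EdgeRanks.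
Variable B : diagram.
Hypothesis HB : ordered_bratteli B.

Lemma elt_trans n (e f g : edg B n) : elt e f -> elt f g -> elt e g.
Proof.
have [_ anti trans _] := HB.2 n.
move=> /andP[nef lef] /andP[nfg lfg]; apply/andP; split; last exact: trans lfg.
by apply: contraNneq nef => ?; subst g; apply/eqP/anti; rewrite lef.
Qed.

Lemma elt_rng n (e f : edg B n) : elt e f -> rng e = rng f.
Proof.
have [_ _ _ cmp] := HB.2 n.
by move=> /andP[_ lef]; apply/eqP; rewrite -cmp lef.
Qed.

Lemma elt_total n (e f : edg B n) :
  rng e = rng f -> e != f -> elt e f \/ elt f e.
Proof.
have [_ _ _ cmp] := HB.2 n.
move=> /eqP; rewrite -cmp /elt (eq_sym f) => + ->.
by case/orP; [left|right].
Qed.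

Lemma elt_rank n (e f : edg B n) : elt e f -> erank e < erank f.
Proof.
move=> lef; apply: proper_card; apply/properP; split.
  by apply/fintype.subsetP => g; rewrite !inE => /elt_trans; apply.
by exists e; rewrite !inE // /elt eqxx.
Qed.

(** Reduces the order of edges to arithmetic with ranks. *)
Lemma eltE n (e f : edg B n) : elt e f = (rng e == rng f) && (erank e < erank f).
Proof.
apply/idP/andP=> [lef|[/eqP er]].
  by split; [apply/eqP/elt_rng|apply: elt_rank].
have [->|nef lr] := eqVneq e f; first by rewrite ltnn.
by case: (elt_total er nef) => // /elt_rank; lia.
Qed.

Lemma erank_inj n (e f : edg B n) : rng e = rng f -> erank e = erank f -> e = f.
Proof.
move=> er ek; apply/eqP; apply: contraT => nef.
by case: (elt_total er nef) => /elt_rank; lia.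
Qed.

Lemma erank_bound n (e : edg B n) : erank e < nedges (rng e).
Proof.
apply: proper_card; apply/properP; split.
  by apply/fintype.subsetP => g; rewrite !inE => /elt_rng ->.
by exists e; rewrite !inE ?eqxx // /elt eqxx.
Qed.

(** Counting predecessors within [S] is injective on [S], with values below
    [#|S|], hence takes all these values. *)
Lemma exists_rank_in n (v : vtx B n.+1) (S : {set edg B n}) k :
  {in S, forall e, rng e = v} -> k < #|S| ->
  exists2 e, e \in S & #|[set f in S | elt f e]%SET| = k.
Proof.
move=> Sv kS; pose rk e := #|[set f in S | elt f e]%SET|.
have rk_lt e f : e \in S -> elt e f -> rk e < rk f.
  move=> eS lef; apply: proper_card; apply/properP; split.
    apply/fintype.subsetP => g; rewrite !inE => /andP[-> lge] /=.
    exact: elt_trans lef.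
  by exists e; rewrite !inE ?eS // /elt eqxx andbF.
have sub : {subset map rk (enum S) <= iota 0 #|S|}.
  move=> _ /mapP[e + ->]; rewrite mem_enum mem_iota add0n => eS.
  apply: proper_card; apply/properP; split.
    by apply/fintype.subsetP => f; rewrite !inE => /andP[].
  by exists e; rewrite ?inE ?eS // /elt eqxx.
have unq : uniq (map rk (enum S)).
  rewrite map_inj_in_uniq ?enum_uniq // => e f; rewrite !mem_enum => eS fS ef.
  apply/eqP; apply: contraT => nef.
  have [|/(rk_lt _ _ eS)|/(rk_lt _ _ fS)] := elt_total _ nef; last 2 first.
  - by rewrite ef ltnn.
  - by rewrite ef ltnn.
  by rewrite !Sv.
have [|_ eqi] := uniq_min_size unq sub; first by rewrite size_iota size_map -cardE.
have : k \in map rk (enum S) by rewrite eqi mem_iota.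
by case/mapP => e; rewrite mem_enum => eS ->; exists e.
Qed.

Lemma exists_rank n (v : vtx B n.+1) k :
  k < nedges v -> exists e : edg B n, rng e = v /\ erank e = k.
Proof.
move=> /(exists_rank_in (v := v))[e|e eS <-]; first by rewrite inE => /eqP.
exists e; split; first by move: eS; rewrite inE => /eqP.
apply: eq_card => f; rewrite !inE andb_idl // => /elt_rng ->.
by move: eS; rewrite inE.
Qed.

Lemma emin_rank n (e : edg B n) : emin e = (erank e == 0).
Proof.
rewrite /erank cards_eq0 /emin; apply/forallP/eqP => [H|H e'].
  by apply/setP => e'; rewrite !inE; apply/negbTE.
by move/setP: H => /(_ e'); rewrite !inE => ->.
Qed.

Lemma emax_rank n (e : edg B n) : emax e = ((erank e).+1 == nedges (rng e)).
Proof.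
apply/forallP/eqP => [H|H f].
  have := erank_bound e; rewrite leq_eqVlt => /orP[/eqP //|/exists_rank].
  move=> [f [rf kf]]; have := H f.
  by rewrite eltE rf kf eqxx ltnSn.
apply/negP; rewrite eltE => /andP[/eqP er].
by have := erank_bound f; rewrite -er; lia.
Qed.

Lemma nedges_gt0 n (v : vtx B n.+1) : 0 < nedges v.
Proof.
have [_ _ /(_ n v)[e <-]] := HB.1.
exact: leq_ltn_trans (erank_bound e).
Qed.

Lemma emin_exists n (v : vtx B n.+1) : exists e, rng e = v /\ emin e.
Proof.
have [e [re ke]] := exists_rank (nedges_gt0 v).
by exists e; rewrite emin_rank ke.
Qed.

Lemma emax_exists n (v : vtx B n.+1) : exists e, rng e = v /\ emax e.
Proof.
have v0 := nedges_gt0 v.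
have [|e [re ke]] := @exists_rank n v (nedges v).-1; first by lia.
by exists e; rewrite emax_rank ke re prednK.
Qed.

Lemma emin_inj n (e f : edg B n) : rng e = rng f -> emin e -> emin f -> e = f.
Proof.
by rewrite !emin_rank => re /eqP ke /eqP kf; apply: erank_inj; rewrite ?ke.
Qed.

Lemma emax_inj n (e f : edg B n) : rng e = rng f -> emax e -> emax f -> e = f.
Proof.
rewrite !emax_rank => re /eqP ke /eqP kf; apply: erank_inj => //.
by move: ke; rewrite re -kf => -[].
Qed.

End EdgeRanks.

(** * Paths with a prescribed head *)

Section Splice.
Variable B : diagram.

(** The head is built from the top down: the vertex where the edge at level [i]
    must end is known once the edge at level [i.+1] is. *)
Lemma splice_raw (sel : forall m, vtx B m.+1 -> edg B m) n (x : forall i, edg B i) :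
  (forall m v, rng (sel m v) = v) ->
  (forall i, n <= i -> src (x i.+1) = rng (x i)) ->
  exists b : XB B, (forall i, n <= i -> b i = x i) /\
                   (forall i, i < n -> b i = sel i (rng (b i))).
Proof.
move=> rsel; elim: n x => [|n IH] x xP.
  by exists (Path (fun i => xP i isT)).
pose x' := dfwith x n (sel n (src (x n.+1))).
have x'n : x' n = sel n (src (x n.+1)) by rewrite /x' dfwithin.
have x'i i : n < i -> x' i = x i by move=> ?; rewrite /x' dfwithout//; lia.
have [|b [bx bs]] := IH x'.
  move=> i; rewrite leq_eqVlt => /orP[/eqP <-|ni]; last first.
    by rewrite !x'i ?xP //; lia.
  by rewrite x'n x'i // rsel.
exists b; split=> i ni; first by rewrite bx ?x'i //; lia.
move: ni; rewrite ltnS leq_eqVlt => /orP[/eqP->|]; last exact: bs.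
by rewrite bx // x'n rsel.
Qed.

Lemma splice (P : forall m, edg B m -> Prop) n (a : XB B) (e : edg B n) :
  (forall m (v : vtx B m.+1), exists e, rng e = v /\ P m e) ->
  rng e = rng (a n) ->
  exists b : XB B, [/\ forall i, n < i -> b i = a i, b n = e
                     & forall i, i < n -> P i (b i)].
Proof.
move=> exP re.
have [sel selP] : {sel : forall m, vtx B m.+1 -> edg B m |
                  forall m v, rng (sel m v) = v /\ P m (sel m v)}.
  have S m v := cid (exP m v).
  by exists (fun m v => sval (S m v)) => m v; case: (S m v).
have [||b [bx bs]] := @splice_raw sel n (dfwith a n e).
- by move=> m v; case: (selP m v).
- move=> i; rewrite leq_eqVlt => /orP[/eqP <-|ni].
    by rewrite dfwithin dfwithout ?path_edgeP //; lia.
  by rewrite !dfwithout ?path_edgeP //; lia.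
exists b; split=> [i ni||i ni].
- by rewrite bx ?dfwithout //; lia.
- by rewrite bx // dfwithin.
- by rewrite bs //; case: (selP i (rng (b i))).
Qed.

(** The vertex where level [i] ends is determined by level [i.+1], so a property
    that singles out one edge into each vertex determines the head.  Used with [P] the
    minimality or the maximality of edges. *)
Lemma head_unique (P : forall m, edg B m -> Prop) n (a b : XB B) :
  (forall m (e f : edg B m), rng e = rng f -> P m e -> P m f -> e = f) ->
  (forall i, n <= i -> a i = b i) ->
  (forall i, i < n -> P i (a i) /\ P i (b i)) -> a = b.
Proof.
move=> Pinj; elim: n => [|n IH] ab pab; first by apply: XB_ext => i; exact: ab.
apply: IH => i; last by move=> ?; apply: pab; lia.
rewrite leq_eqVlt => /orP[/eqP <-|]; last exact: ab.
have [pa pb] := pab n (ltnSn _).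
by apply: Pinj pa pb; rewrite -!path_edgeP ab.
Qed.

End Splice.

(** * Successors of paths *)

Section Successor.
Variable B : diagram.
Hypothesis HB : ordered_bratteli B.
Implicit Types a b x y : XB B.

(** Addition of one with carry.  Every statement about [vershik] goes through this
    form, in which each of [a] and [b] determines the other. *)
Definition succ_at n a b : Prop :=
  [/\ forall i, i < n -> emax (a i) /\ emin (b i),
      rng (b n) = rng (a n), erank (b n) = (erank (a n)).+1 &
      forall i, n < i -> b i = a i].

Lemma erankS_not_min n (e : edg B n) k : erank e = k.+1 -> emin e = false.
Proof. by move=> ek; rewrite emin_rank ek. Qed.

Lemma erankS_not_max n (e f : edg B n) :
  rng f = rng e -> erank f = (erank e).+1 -> emax e = false.
Proof.
move=> re ke; rewrite (emax_rank HB) -ke -re.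
by have := erank_bound HB f; lia.
Qed.

Lemma succ_at_exists a : ~ pmax a -> exists n b, succ_at n a b.
Proof.
move=> /existsNP ex.
have {}ex : exists n, ~~ emax (a n) by case: ex => n /negP; exists n.
(* Carry: the first nonmaximal edge is raised, all lower ones are reset. *)
have [n nm mn] := ex_minnP ex.
have [e [re ke]] : exists e, rng e = rng (a n) /\ erank e = (erank (a n)).+1.
  apply: (exists_rank HB); move: nm; rewrite (emax_rank HB).
  by have := erank_bound HB (a n); lia.
have [b [ba bn bm]] := splice (P := fun m e => emin e) (emin_exists HB) re.
exists n, b; split=> [i ni|||//]; rewrite ?bn //.
by split; [apply: contraT => /mn; lia|exact: bm].
Qed.

Lemma pred_at_exists b : ~ pmin b -> exists n a, succ_at n a b.
Proof.
move=> /existsNP ex.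
have {}ex : exists n, ~~ emin (b n) by case: ex => n /negP; exists n.
have [n nm mn] := ex_minnP ex.
have [e [re ke]] : exists e, rng e = rng (b n) /\ erank e = (erank (b n)).-1.
  by apply: (exists_rank HB); have := erank_bound HB (b n); lia.
have [a [ab an am]] := splice (P := fun m e => emax e) (emax_exists HB) re.
exists n, a; split=> [i ni|||i ni].
- by split; [exact: am|apply: contraT => /mn; lia].
- by rewrite an.
- by rewrite an ke prednK // lt0n -emin_rank.
- by rewrite ab.
Qed.

Lemma succ_at_det n m a b b' : succ_at n a b -> succ_at m a b' -> b = b'.
Proof.
move=> [H1 H2 H3 H4] [K1 K2 K3 K4].
have nm : n = m.
  case: (ltngtP n m) => // h.
    by have [] := K1 _ h; rewrite (erankS_not_max H2 H3).
  by have [] := H1 _ h; rewrite (erankS_not_max K2 K3).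
subst m; apply: (head_unique (n := n) (P := fun m e => emin e)).
- exact: emin_inj.
- move=> i; rewrite leq_eqVlt => /orP[/eqP <-|ni]; last by rewrite H4 ?K4.
  by apply: (erank_inj HB); rewrite ?H2 ?H3.
- by move=> i ni; split; [case: (H1 i ni)|case: (K1 i ni)].
Qed.

Lemma succ_at_inj n m a a' b : succ_at n a b -> succ_at m a' b -> a = a'.
Proof.
move=> [H1 H2 H3 H4] [K1 K2 K3 K4].
have nm : n = m.
  case: (ltngtP n m) => // h.
    by have [_] := K1 _ h; rewrite (erankS_not_min H3).
  by have [_] := H1 _ h; rewrite (erankS_not_min K3).
subst m; apply: (head_unique (n := n) (P := fun m e => emax e)).
- exact: emax_inj.
- move=> i; rewrite leq_eqVlt => /orP[/eqP <-|ni]; last by rewrite -H4 ?K4.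
  by apply: (erank_inj HB); [rewrite -H2|move: H3; rewrite K3 => -[]].
- by move=> i ni; split; [case: (H1 i ni)|case: (K1 i ni)].
Qed.

(** Nothing fits between: if [a < c < b], compare the last levels where [c] differs
    from [a] and from [b]; unless one of them is [n] and the ranks there clash, a
    maximal edge of [a] would have to increase or a minimal edge of [b] to decrease. *)
Lemma succ_atP n a b : succ_at n a b -> successor a b.
Proof.
move=> [H1 H2 H3 H4].
have ltab : elt (a n) (b n) by rewrite (eltE HB) H2 eqxx H3 ltnSn.
split; first by exists n; split=> // i /H4 ->.
move=> [c [[p [lac eac]] [q [lcb ecb]]]].
have no m (e : edg B m) : elt e e -> False by rewrite /elt eqxx.
case: (ltngtP p q) => pq.
- have acq := eac _ pq; case: (ltngtP n q) => nq.
  + by move: lcb; rewrite -acq H4 // => /no.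
  + by move: ltab; rewrite eac ?ecb //; [move=> /no|lia].
  + have [amax _] := H1 p ltac:(lia).
    by move/forallP: amax => /(_ (c p)); rewrite lac.
- have cbp := ecb _ pq; case: (ltngtP n p) => np.
  + by move: lac; rewrite cbp H4 // => /no.
  + by move: ltab; rewrite eac ?ecb //; [move=> /no|lia].
  + have [_ bmin] := H1 q ltac:(lia).
    by move/forallP: bmin => /(_ (c q)); rewrite lcb.
- subst q; case: (ltngtP n p) => np.
  + by move: (elt_trans HB lac lcb); rewrite H4 // => /no.
  + by move: ltab; rewrite eac ?ecb // => /no.
  + subst p; move: (elt_rank HB lac) (elt_rank HB lcb); rewrite H3; lia.
Qed.

(** Eventually equal paths end in the same vertex on the last level where they
    differ, so the edges there are comparable. *)
Lemma plt_total N a b : (forall i, N <= i -> a i = b i) -> a <> b ->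
  plt a b \/ plt b a.
Proof.
elim: N => [|N IH] eab nab; first by case: nab; apply: XB_ext => i; exact: eab.
have [eN|nN] := eqVneq (a N) (b N).
  apply: IH => // i; rewrite leq_eqVlt => /orP[/eqP <- //|]; exact: eab.
have rN : rng (a N) = rng (b N) by rewrite -!path_edgeP eab.
case: (elt_total HB rN nN) => l; [left|right]; exists N; split=> // i /eab //.
Qed.

(** The path obtained from [succ_at_exists] is a successor, and two successors
    of the same path are eventually equal, hence comparable, hence equal. *)
Lemma successorP a b : successor a b <-> exists n, succ_at n a b.
Proof.
split=> [sab|[n]]; last exact: succ_atP.
have [m [lab eab]] := sab.1.
have [|n [b' sb']] := @succ_at_exists a.
  by move=> /(_ m) /forallP /(_ (b m)); rewrite lab.
exists n; suff -> : b = b' by [].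
apply/eqP; apply: contraT => /eqP nbb.
have [|lt|lt] := @plt_total (maxn n m).+1 b b' _ nbb.
- move=> i ni; have [_ _ _ H4] := sb'.
  by rewrite -eab ?H4 //; lia.
- by have [_ []] := succ_atP sb'; exists b; split=> //; exact: sab.1.
- by have [_ []] := sab; exists b'; split=> //; have [] := succ_atP sb'.
Qed.

End Successor.

(** * The Vershik map *)

Section Vershik.
Variable B : diagram.
Hypotheses (HB : ordered_bratteli B) (Hp : properly_ordered B).
Implicit Types a b x y : XB B.

Lemma pmax_unique a b : pmax a -> pmax b -> a = b.
Proof. by have [[c [_ u]] _] := Hp; move=> /u <- /u. Qed.

Lemma pmin_unique a b : pmin a -> pmin b -> a = b.
Proof. by have [_ [c [_ u]]] := Hp; move=> /u <- /u. Qed.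

Lemma vershik_max a : pmax a -> pmin (vershik a).
Proof.
move=> ma; rewrite /vershik; case: asboolP => // _.
have [_ [c [mc _]]] := Hp.
exact: (@xgetPex _ a [set b | pmin b]) (ex_intro _ c mc).
Qed.

Lemma vershikE n a b : succ_at n a b -> vershik a = b.
Proof.
move=> sab; rewrite /vershik; case: asboolP => [ma|nm].
  by have [_ H2 H3 _] := sab; have := ma n; rewrite (erankS_not_max HB H2 H3).
apply: xget_unique; first exact: succ_atP sab.
by move=> c /(successorP HB)[m sac]; exact: (succ_at_det HB sac sab).
Qed.

Lemma vershik_succ a : ~ pmax a -> exists n, succ_at n a (vershik a).
Proof.
move=> /(succ_at_exists HB)[n [b sab]].
by exists n; rewrite (vershikE sab).
Qed.

(** The level [n] of [succ_at n a b] is the first one where [b] is not minimal,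
    and this determines [a]; a minimal path can only come from the maximal one. *)
Lemma vershik_inj : injective (@vershik B).
Proof.
have H a b : pmax a -> vershik a = vershik b -> a = b.
  move=> ma eab; have [mb|nb] := pselect (pmax b); first exact: pmax_unique.
  have [n [_ _ H3 _]] := vershik_succ nb.
  by have := vershik_max ma n; rewrite eab (erankS_not_min H3).
move=> a b eab.
have [ma|na] := pselect (pmax a); first exact: H.
have [mb|nb] := pselect (pmax b); first by apply/esym/H.
have [n sa] := vershik_succ na; have [m sb] := vershik_succ nb.
by apply: (succ_at_inj HB) sa _; rewrite eab; exact: sb.
Qed.

Lemma vershik_surj b : exists a, vershik a = b.
Proof.
have [mb|nb] := pselect (pmin b).
  have [[c [mc _]] _] := Hp.
  by exists c; apply: pmin_unique mb; exact: vershik_max.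
have [n [a sab]] := pred_at_exists HB nb.
by exists a; exact: vershikE sab.
Qed.

Lemma vershik_invK : cancel (@vershik_inv B) (@vershik B).
Proof.
move=> b; rewrite /vershik_inv.
exact: (@xgetPex _ b [set a | vershik a = b]) (vershik_surj b).
Qed.

Lemma vershikK : cancel (@vershik B) (@vershik_inv B).
Proof. by move=> b; apply: vershik_inj; rewrite vershik_invK. Qed.

Lemma iter_vershikK n : cancel (iter n (@vershik B)) (iter n (@vershik_inv B)).
Proof. by elim: n => // n IH a; rewrite iterSr /= vershikK IH. Qed.

(** Once the edges below level [n] are maximal, the next step raises the edge at
    level [n] by one, as long as this is not maximal. *)
Lemma reach_max n a : exists t,
  (forall i, i < n -> emax (iter t vershik a i)) /\
  (forall i, n <= i -> iter t vershik a i = a i).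
Proof.
elim: n a => [|n IH] a; first by exists 0.
have [k] := ubnP (nedges (rng (a n)) - erank (a n)).
elim: k a => // k IHk a lk.
have [t [tm ta]] := IH a; set y := iter t vershik a in tm ta.
have [ymax|nymax] := boolP (emax (y n)).
  exists t; split=> i; last by move=> /ltnW; exact: ta.
  by rewrite ltnS leq_eqVlt => /orP[/eqP ->|]; last exact: tm.
have ny : ~ pmax y by move=> /(_ n); apply/negP.
have [m sy] := vershik_succ ny.
have [H1 H2 H3 H4] := sy.
have mn : m = n.
  case: (ltngtP m n) => // h; first by have := tm _ h; rewrite (erankS_not_max HB H2 H3).
  by have [] := H1 _ h; rewrite (negbTE nymax).
subst m; have yn : y n = a n by apply: ta.
have [|s [sm sa]] := IHk (vershik y).
  rewrite H2 H3 yn; move: (erank_bound HB (a n)) lk; lia.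
exists (s + t.+1); rewrite iterD /= -/y; split=> // i ni.
by rewrite sa // H4 // ta //; lia.
Qed.

(** Both paths run up to the same path, the one with maximal head and the common
    tail. *)
Lemma same_orbit n a b : (forall i, n <= i -> a i = b i) ->
  exists z, vershik_iter z a = b.
Proof.
move=> eab; have [s [sm sa]] := reach_max n a; have [t [tm tb]] := reach_max n b.
have e : iter s vershik a = iter t vershik b.
  apply: (head_unique (n := n) (P := fun m e => emax e)).
  - exact: emax_inj.
  - by move=> i ni; rewrite sa ?tb ?eab.
  - by move=> i ni; split; [exact: sm|exact: tm].
have [ts|st] := leqP t s.
  exists (Posz (s - t)); apply: (can_inj (iter_vershikK t)).
  by rewrite /= -iterD subnKC.
exists (Negz (t - s).-1); rewrite /vershik_iter prednK; last by lia.
rewrite -(_ : iter (t - s) vershik b = a) ?iter_vershikK //.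
apply: (can_inj (iter_vershikK s)).
by rewrite /= -iterD subnKC // ltnW.
Qed.

(** Such an orbit avoids the maximal path, so each step changes finitely many
    levels. *)
Lemma orbit_tail a t : (exists N, forall m, N <= m -> ~~ extremal (a m)) ->
  exists N, forall m, N <= m -> iter t vershik a m = a m.
Proof.
move=> [N0 H0]; elim: t => [|t [N IH]]; first by exists 0.
have nm : ~ pmax (iter t vershik a).
  move=> /(_ (maxn N N0)); rewrite IH ?leq_maxl // => ma.
  by have := H0 _ (leq_maxr N N0); rewrite /extremal ma orbT.
have [p [_ _ _ H4]] := vershik_succ nm.
by exists (maxn N p.+1) => m hm; rewrite /= H4 ?IH //; lia.
Qed.

Lemma vershik_iter_tail a z : (exists N, forall m, N <= m -> ~~ extremal (a m)) ->
  exists N, forall m, N <= m -> vershik_iter z a m = a m.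
Proof.
case: z => t; first exact: orbit_tail.
move=> [N0 H0]; rewrite /vershik_iter.
elim: t.+1 => [|s [N IH]]; first by exists 0.
rewrite iterS; set y := iter s (@vershik_inv B) a in IH *.
have vy : vershik (vershik_inv y) = y by exact: vershik_invK.
have nm : ~ pmax (vershik_inv y).
  move=> /vershik_max; rewrite vy => /(_ (maxn N N0)).
  rewrite IH ?leq_maxl // => ma.
  by have := H0 _ (leq_maxr N N0); rewrite /extremal ma.
have [p [_ _ _]] := vershik_succ nm; rewrite vy => H4.
by exists (maxn N p.+1) => m hm; rewrite -H4 ?IH //; lia.
Qed.

Lemma orbit_extremal a i : (exists N, forall m, N <= m -> extremal (a m)) ->
  exists N, forall m, N <= m -> extremal (iter i vershik a m).
Proof.
move=> ea; elim: i => [//|i [N HN]]; set x := iter i vershik a in HN *.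
have [mx|nmx] := pselect (pmax x).
  by exists 0 => m _; rewrite /extremal /= -/x (vershik_max mx).
have [p [_ _ _ H4]] := vershik_succ nmx.
by exists (maxn N p.+1) => m hm; rewrite iterS H4 ?HN //; lia.
Qed.

End Vershik.

(** * The cylinder topology *)

Section Cylinders.
Variable B : diagram.
Implicit Types a b x : XB B.

Lemma cylinder_nbhs n a : nbhs a (cylinder n a).
Proof.
apply: open_nbhs_nbhs; split; last by move=> i _.
exists [set cylinder n a]; last by rewrite bigcup_set1.
by move=> _ ->; apply: (@finI_from1 _ _ _ id); exists n, a.
Qed.

(** A finite intersection of cylinders around [a] contains the smallest of
    them. *)
Lemma nbhs_cylinder a (U : set (XB B)) : nbhs a U -> exists n, cylinder n a `<=` U.
Proof.
rewrite nbhsE => -[V [[D sD <-] [A DA Aa]] VU].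
have [E sE AE] := sD _ DA.
have rad C : exists n, C \in E -> cylinder n a `<=` C.
  have [CE|_] := boolP (C \in E); last by exists 0.
  have [n [c Cc]] := set_mem (sE _ CE); exists n => _ b ab.
  have : C a by move: Aa; rewrite -AE; apply.
  by rewrite Cc => ca i ni; rewrite ca // ab.
have [f fP] := choice rad.
exists (\max_(C <- E) f C) => b ab; apply: VU; exists A => //.
(* [A] is an index of the base of the topology, which is indexed by itself. *)
suff : (A : set (XB B)) b by [].
rewrite -AE => C /= CE; apply: (fP C CE) => i iC; apply: ab.
by apply: leq_trans iC _; apply: leq_bigmax_seq.
Qed.

End Cylinders.

(** * Paths of the copied diagram as sequences of copy indices *)

Section Copies.
Variables (B : diagram) (c : copying B).
Notation hB := (copy_paste c).
Implicit Types (a : XB B) (b : XB hB).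

(** The attaching map on plain natural numbers, so that indices of edges over
    different vertices can be compared without casts. *)
Definition att n (e : edg B n) (j : nat) : nat :=
  if insub j is Some o then attach (o : 'I_(ncopies c (rng e))) else 0.

Definition idx b n : nat := tagged (b n : copy_edg c n).

Lemma att_ord n (e : edg B n) (o : 'I_(ncopies c (rng e))) : att e o = attach o.
Proof. by rewrite /att valK. Qed.

Lemma att_lt n (e : edg B n) j :
  j < ncopies c (rng e) -> att e j < ncopies c (src e).
Proof. by move=> je; rewrite (att_ord (Ordinal je)). Qed.

Lemma idx_lt b n : idx b n < ncopies c (rng (collapse c b n)).
Proof. exact: ltn_ord. Qed.

Lemma idx_step b n : idx b n = att (collapse c b n.+1) (idx b n.+1).
Proof.
rewrite /idx att_ord.
have := congr1 (fun x : copy_vtx c n.+1 => nat_of_ord (tagged x)) (path_edgeP b n).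
by move=> /= ->.
Qed.

Lemma copy_vtx_eq n (x y : copy_vtx c n) :
  tag x = tag y -> tagged x = tagged y :> nat -> x = y.
Proof.
case: x y => [v i] [w j] /= vw; case: _ / vw j => j ij.
by congr existT; apply: val_inj.
Qed.

Lemma copy_edg_eq n (x y : copy_edg c n) :
  tag x = tag y -> tagged x = tagged y :> nat -> x = y.
Proof.
case: x y => [v i] [w j] /= vw; case: _ / vw j => j ij.
by congr existT; apply: val_inj.
Qed.

Lemma lift_unique b b' :
  collapse c b = collapse c b' -> (forall n, idx b n = idx b' n) -> b = b'.
Proof.
move=> ebb ei; apply: XB_ext => n; apply: copy_edg_eq; last exact: ei.
exact: (congr1 (fun a : XB B => a n) ebb).
Qed.

Lemma lift_exists a (j : nat -> nat) :
  (forall n, j n < ncopies c (rng (a n))) ->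
  (forall n, att (a n.+1) (j n.+1) = j n) ->
  exists b, collapse c b = a /\ forall n, idx b n = j n.
Proof.
move=> jlt jP.
pose x n : edg hB n :=
  Tagged (fun e : edg B n => 'I_(ncopies c (rng e))) (Ordinal (jlt n)).
have xP n : src (x n.+1) = rng (x n).
  apply: copy_vtx_eq => /=; first exact: path_edgeP.
  by rewrite -att_ord; exact: jP.
by exists (Path xP); split=> //; apply: XB_ext.
Qed.

(** * The collapsing map, the edge order and the Vershik map *)

Hypothesis HB : ordered_bratteli B.

Lemma copy_edge_order : edge_order hB.
Proof.
move=> n; have [refl anti trans cmp] := HB.2 n; split.
- by move=> x; apply/andP; split; [exact: eqxx|exact: refl].
- move=> x y /andP[/andP[/eqP ej le] /andP[_ ge]].
  by apply: copy_edg_eq ej; apply: anti; rewrite le.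
- move=> y x z /andP[/eqP xy le] /andP[/eqP yz le'].
  by apply/andP; split; [rewrite xy yz|exact: trans le'].
- move=> x y; rewrite /= /copy_ele (eq_sym (tagged y : nat)) -andb_orr cmp.
  apply/andP/eqP => [[/eqP ej /eqP er]|er].
    exact: copy_vtx_eq.
  by split; apply/eqP;
    [exact: (congr1 (fun v : copy_vtx c n.+1 => nat_of_ord (tagged v)) er)
    |exact: (congr1 (@tag _ _) er)].
Qed.

Lemma copy_elt n (x y : edg hB n) :
  elt x y = (tagged x == tagged y :> nat) && elt (tag x) (tag y).
Proof.
apply/andP/andP => [[nxy /andP[ej le]]|[ej /andP[nxy le]]].
  split=> //; rewrite /elt le andbT; apply: contraNneq nxy => txy.
  by apply/eqP/copy_edg_eq => //; apply/eqP.
by split; [apply: contraNneq nxy => ->|apply/andP].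
Qed.

(** The edges comparable to a copied edge are the copies, with the same index,
    of the edges comparable to the original. *)
Lemma erank_copy n (x : edg hB n) : erank x = erank (tag x).
Proof.
rewrite /erank -(card_in_imset (f := @tag _ _) (D := [set y : edg hB n | elt y x]%SET)).
  apply: eq_card => e; rewrite !inE; apply/imsetP/idP => [[y]|lex].
    by rewrite inE copy_elt => /andP[_ ?] ->.
  have jlt : tagged x < ncopies c (rng e) by rewrite (elt_rng HB lex).
  exists (Tagged (fun e : edg B n => 'I_(ncopies c (rng e))) (Ordinal jlt)) => //.
  by rewrite inE copy_elt eqxx.
move=> y z; rewrite !inE !copy_elt => /andP[/eqP ty _] /andP[/eqP tz _] tyz.
by apply: copy_edg_eq; rewrite // ty tz.
Qed.

Lemma emin_copy n (x : edg hB n) : emin x = emin (tag x).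
Proof. by rewrite !emin_rank erank_copy. Qed.

Lemma emax_copy n (x : edg hB n) : emax x = emax (tag x).
Proof.
apply/forallP/forallP => H e.
  apply/negP => le; have jlt : tagged x < ncopies c (rng e) by rewrite -(elt_rng HB le).
  have := H (Tagged (fun e : edg B n => 'I_(ncopies c (rng e))) (Ordinal jlt)).
  by rewrite copy_elt eqxx le.
by rewrite copy_elt negb_and H orbT.
Qed.

Lemma extremal_copy n (x : edg hB n) : extremal x = extremal (tag x).
Proof. by rewrite /extremal emin_copy emax_copy. Qed.

(** Collapsing keeps ranks, minimality and maximality, so it keeps the explicit
    form of successors.  This is what makes it equivariant. *)
Lemma collapse_succ_at n b b' :
  succ_at n b b' -> succ_at n (collapse c b) (collapse c b').
Proof.
move=> [H1 H2 H3 H4]; split=> [i ni|||i ni] /=.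
- by have := H1 _ ni; rewrite emax_copy emin_copy.
- exact: (congr1 (@tag _ _) H2).
- by rewrite -!erank_copy.
- by rewrite H4.
Qed.

Lemma pmin_collapse b : pmin (collapse c b) <-> pmin b.
Proof. by split=> H n; have := H n; rewrite emin_copy. Qed.

Lemma pmax_collapse b : pmax (collapse c b) <-> pmax b.
Proof. by split=> H n; have := H n; rewrite emax_copy. Qed.

Lemma collapse_continuous : continuous (collapse c).
Proof.
move=> b U /nbhs_cylinder[n nU]; apply: filterS (cylinder_nbhs n b) => b' bb'.
by apply: nU => i ni; rewrite /= bb'.
Qed.

Section Equivariance.
Hypotheses (Hp : properly_ordered B).
Hypotheses (HhB : ordered_bratteli hB) (HhP : properly_ordered hB).

Lemma collapse_vershik b : collapse c (vershik b) = vershik (collapse c b).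
Proof.
have [mb|nb] := pselect (pmax b).
  apply: (pmin_unique Hp); first exact/pmin_collapse/(vershik_max HhP).
  by apply: (vershik_max Hp); apply/pmax_collapse.
have [n sb] := vershik_succ HhB nb.
by rewrite (vershikE HB (collapse_succ_at sb)).
Qed.

Lemma collapse_vershik_inv b :
  collapse c (vershik_inv b) = vershik_inv (collapse c b).
Proof.
by rewrite -{2}(vershik_invK HhB HhP b) collapse_vershik (vershikK HB Hp).
Qed.

Lemma collapse_vershik_iter z b :
  collapse c (vershik_iter z b) = vershik_iter z (collapse c b).
Proof.
case: z => n; rewrite /vershik_iter.
  by elim: n => //= n <-; exact: collapse_vershik.
by elim: n.+1 => //= {}n <-; exact: collapse_vershik_inv.
Qed.

End Equivariance.
End Copies.

(** * Thick, thin and extremal edges *)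

Section Colours.
Variables (B : diagram) (M : forall n, vtx B n.+1 -> nat).
Hypotheses (HB : ordered_bratteli B) (Hcol : coloured M).

(** The intrinsic description of the set D, see [DsetP]. *)
Definition one_thin (a : XB B) : Prop :=
  (forall m, 0 < m -> ~~ extremal (a m)) /\
  (forall m m', 0 < m -> m < m' -> thin M (a m) -> ~~ thin M (a m')).

Lemma extremal_rank n (e : edg B n) :
  extremal e = (erank e == 0) || ((erank e).+1 == nedges (rng e)).
Proof. by rewrite /extremal emin_rank (emax_rank HB). Qed.

Lemma nedges_ge5 n (v : vtx B n.+1) : 0 < n -> 4 < nedges v.
Proof. by move=> /(Hcol v); lia. Qed.

Lemma thick_or_thin n (e : edg B n) : ~~ extremal e -> thick M e \/ thin M e.
Proof.
rewrite extremal_rank /thick /thin => ne.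
have := erank_bound HB e; have [] := leqP (erank e) (M (rng e)); first by left; lia.
by right; lia.
Qed.

Lemma thick_nonextremal n (e : edg B n) : 0 < n -> thick M e -> ~~ extremal e.
Proof. by move=> /(Hcol (rng e)); rewrite extremal_rank /thick; lia. Qed.

Lemma thick_by_exclusion n (e : edg B n) : ~~ extremal e -> ~~ thin M e -> thick M e.
Proof. by move=> /thick_or_thin[// | ->]. Qed.

Lemma not_thick_thin n (e : edg B n) : thick M e -> thin M e -> False.
Proof. by rewrite /thick /thin; lia. Qed.

End Colours.

Section ThickPaths.
Variables (B : diagram) (M : forall n, vtx B n.+1 -> nat).
Hypotheses (HB : ordered_bratteli B) (Hcol : coloured M).

Lemma thick_exists n (v : vtx B n.+1) :
  exists e : edg B n, rng e = v /\ (0 < n -> thick M e).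
Proof.
case: n v => [|n] v.
  by have [e [re _]] := emin_exists HB v; exists e.
have [|e [re ke]] := exists_rank HB (v := v) (k := 1).
  by have := nedges_ge5 Hcol v (ltn0Sn n); lia.
exists e; split=> // _; rewrite /thick ke re.
by have := Hcol v (ltn0Sn n); lia.
Qed.

Lemma thick_head n (a : XB B) : exists b : XB B,
  (forall i, n < i -> b i = a i) /\
  (forall i, 0 < i -> i <= n -> thick M (b i)).
Proof.
have [e [re te]] := thick_exists (rng (a n)).
have [b [ba be bt]] := splice (P := fun m e => 0 < m -> thick M e) thick_exists re.
exists b; split=> // i i0; rewrite leq_eqVlt => /orP[/eqP ni|/bt]; last exact.
by subst i; rewrite be; exact: te.
Qed.

(** Any path can be given thick edges on the levels 1 to [n]; a cluster point of
    the resulting paths, as [n] grows, has thick edges on all levels from 1 on. *)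
Lemma thick_path : cantor_set B -> XB B ->
  exists a : XB B, forall m, 0 < m -> thick M (a m).
Proof.
move=> [f [g [fK gK _ gc]]] p.
have cX : compact [set: XB B].
  have -> : [set: XB B] = g @` setT by apply/seteqP; split=> // x _; exists (f x).
  apply: continuous_compact; last exact: cantor_space_compact.
  exact: continuous_subspaceT.
have [x xP] := choice (fun n => thick_head n p).
have [a [_ clu]] := cX (x @ \oo) _ filterT.
exists a => m m0.
have : (x @ \oo) [set b | thick M (b m)].
  by exists m => // n /= mn; apply: (xP n).2.
by move=> /clu /(_ (cylinder_nbhs m a)) [b [/= tb ->//]].
Qed.

End ThickPaths.

(** * Fibres of the collapsing map *)

Section Extension.
Variables (B : diagram) (v0 : forall n, vtx B n) (M : forall n, vtx B n.+1 -> nat).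
Variable c : copying B.
Hypotheses (HB : ordered_bratteli B) (Hp : properly_ordered B) (Hcol : coloured M).
Hypothesis Hc : forall n (v : vtx B n), 2 <= n.+1 ->
  4 <= #|[set e : edg B n | (src e == v) && (rng e == v0 n.+1)]%SET|.
Hypothesis Hi : forall n (v : vtx B n), 1 <= n ->
  ncopies c v = if v == v0 n then 4 else 3.
Hypothesis Hii : forall n (e : edg B n) (j : 'I_(ncopies c (rng e))), 1 <= n ->
  (emin e -> src e = v0 n /\ attach j = 3 :> nat) /\
  (emax e -> attach j = 0 :> nat).
Hypothesis Hiii : forall n (e : edg B n) (j : 'I_(ncopies c (rng e))), 1 <= n ->
  rng e = v0 n.+1 -> j = 3 :> nat -> 1 <= erank e <= nedges (rng e) - 2 ->
  attach j = #|[set e' | elt e' e && (src e' == src e)]%SET| %% 3 :> nat.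
Hypothesis Hiv : forall n (e : edg B n) (j : 'I_(ncopies c (rng e))), 1 <= n ->
  (thick M e -> j <= 2 -> attach j = j :> nat) /\
  (thin M e -> (j = 0 :> nat \/ j = 1 :> nat -> attach j = 0 :> nat) /\
               (j = 2 :> nat -> attach j = 1 :> nat)).
Notation hB := (copy_paste c).
Implicit Types (a : XB B) (b : XB hB).

Lemma ncopies_bounds n (v : vtx B n) : 0 < n -> 2 < ncopies c v <= 4.
Proof. by move=> /Hi ->; case: ifP. Qed.

Lemma ncopies_gt0 n (v : vtx B n) : 0 < ncopies c v.
Proof.
case: n v => [|n] v; first by rewrite ncopies0.
by have /andP[+ _] := ncopies_bounds v (ltn0Sn n); lia.
Qed.

Lemma att_min n (e : edg B n) j :
  0 < n -> j < ncopies c (rng e) -> emin e -> att c e j = 3.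
Proof.
move=> n0 je me; rewrite (att_ord (Ordinal je)).
by have [/(_ me)[]] := Hii (Ordinal je) n0.
Qed.

Lemma att_max n (e : edg B n) j :
  0 < n -> j < ncopies c (rng e) -> emax e -> att c e j = 0.
Proof.
move=> n0 je me; rewrite (att_ord (Ordinal je)).
by have [_ /(_ me)] := Hii (Ordinal je) n0.
Qed.

Lemma att_thick n (e : edg B n) j : 0 < n -> j <= 2 -> thick M e -> att c e j = j.
Proof.
move=> n0 j2 te; have je : j < ncopies c (rng e).
  by have /andP[+ _] := ncopies_bounds (rng e) (ltn0Sn n); lia.
rewrite (att_ord (Ordinal je)).
by have [/(_ te j2)] := Hiv (Ordinal je) n0.
Qed.

Lemma att_thin n (e : edg B n) j : 0 < n -> j <= 2 -> thin M e -> att c e j = (j == 2).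
Proof.
move=> n0 j2 te; have je : j < ncopies c (rng e).
  by have /andP[+ _] := ncopies_bounds (rng e) (ltn0Sn n); lia.
rewrite (att_ord (Ordinal je)).
have [_ /(_ te)[H0 H2]] := Hiv (Ordinal je) n0.
case: j j2 je H0 H2 => [|[|[|//]]] /= _ je H0 H2; [apply: H0|apply: H0|exact: H2].
  by left.
by right.
Qed.

(** The index 3 occurs only over [v0 n.+1], where a residue modulo 3 is taken. *)
Lemma att_nonextremal n (e : edg B n) j :
  0 < n -> j < ncopies c (rng e) -> ~~ extremal e -> att c e j <= 2.
Proof.
move=> n0 je ne; have [j2|j3] := leqP j 2.
  case: (thick_or_thin M HB ne) => te; first by rewrite att_thick.
  by rewrite att_thin //; case: eqP.
have ej : j = 3 by have /andP[_ +] := ncopies_bounds (rng e) (ltn0Sn n); lia.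
have re : rng e = v0 n.+1.
  by apply/eqP; move: je; rewrite Hi // ej; case: ifP.
rewrite (att_ord (Ordinal je)) Hiii //.
  by rewrite -ltnS ltn_pmod.
by move: ne; rewrite (extremal_rank HB); have := erank_bound HB e; lia.
Qed.

Lemma idx_le2 b n : ~~ extremal (collapse c b n.+1) -> idx b n <= 2.
Proof. by move=> ne; rewrite idx_step att_nonextremal //; exact: idx_lt. Qed.

Section Fibre.
Variables b b' : XB hB.
Hypothesis ebb : collapse c b = collapse c b'.
Let a := collapse c b.

(** The index on a level determines the indices on all lower levels. *)
Lemma idx_neq_up n m : n <= m -> idx b n <> idx b' n -> idx b m <> idx b' m.
Proof.
move=> /subnK <-; elim: (m - n) => [//|d IH] /IH nd e.
by apply: nd; rewrite (idx_step b) (idx_step b') -ebb e.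
Qed.

Lemma fibre_nonextremal n m : idx b n <> idx b' n -> n < m -> ~~ extremal (a m).
Proof.
move=> nn; case: m => // m; rewrite ltnS => /idx_neq_up /(_ nn) nm.
apply/negP => /orP em; apply: nm; rewrite (idx_step b) (idx_step b') -ebb -/a.
have l := idx_lt b m.+1; have l' := idx_lt b' m.+1; rewrite -ebb in l'.
by case: em => em; [rewrite !att_min|rewrite !att_max].
Qed.

Lemma idx_le1_down (x : XB hB) n d : (forall i, n < i -> ~~ extremal (collapse c x i)) ->
  idx x (n + d) <= 1 -> idx x n <= 1.
Proof.
elim: d n => [|d IH] n; first by rewrite addn0.
rewrite addnS -addSn => ne /IH ne1.
have {}ne1 : idx x n.+1 <= 1 by apply: ne1 => i /ltnW; exact: ne.
rewrite idx_step; case: (thick_or_thin M HB (ne n.+1 (ltnSn n))) => te.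
  by rewrite att_thick //; lia.
by rewrite att_thin; [case: eqP|by []|lia|by []].
Qed.

(** The upper thin edge brings the indices into {0, 1}, where the edges between
    keep them, and the lower thin edge sends 0 and 1 to 0. *)
Lemma fibre_one_thin n m m' : idx b n <> idx b' n -> n < m -> m < m' ->
  thin M (a m) -> thin M (a m') -> False.
Proof.
move=> nn nm mm tm tm'.
have H (x : XB hB) : collapse c x = a -> idx x m.-1 = 0.
  move=> xa; have ne i : n < i -> ~~ extremal (collapse c x i).
    by rewrite xa; exact: fibre_nonextremal nn.
  case: m nm mm tm => // m nm mm tm; rewrite /= idx_step xa.
  case: m' mm tm' => // m' mm tm'.
  have le1 : idx x m.+1 <= 1.
    apply: (@idx_le1_down _ _ (m' - m.+1)) => [i ?|]; first by apply: ne; lia.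
    rewrite subnKC // idx_step xa att_thin //; first by case: eqP.
    by apply: idx_le2; apply: ne; lia.
  by rewrite att_thin //; [case: eqP => // e; rewrite e in le1|lia].
have /(idx_neq_up) /(_ nn) : n <= m.-1 by lia.
by rewrite !H.
Qed.

End Fibre.

Lemma fibre_thick b b' n : collapse c b = collapse c b' -> idx b n <> idx b' n ->
  exists N, forall m, N <= m -> thick M (collapse c b m).
Proof.
move=> ebb nn; have ne m := fibre_nonextremal ebb (m := m) nn.
have [[m [nm tm]]|no] := pselect (exists m, n < m /\ thin M (collapse c b m)).
  exists m.+1 => m' mm; apply: (thick_by_exclusion HB); first by apply: ne; lia.
  by apply/negP => /(fibre_one_thin ebb nn nm mm tm).
exists n.+1 => m nm; apply: (thick_by_exclusion HB); first exact: ne.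
by apply/negP => tm; apply: no; exists m.
Qed.

(** The index at level [n] of a partial lift started with the index 0 at level
    [n + d]. *)
Fixpoint idx_from0 a n d : nat :=
  if d is d'.+1 then att c (a n.+1) (idx_from0 a n.+1 d') else 0.

Lemma idx_from0_lt a n d : idx_from0 a n d < ncopies c (rng (a n)).
Proof.
elim: d n => [|d IH] n /=; first exact: ncopies_gt0.
by rewrite -path_edgeP; apply: att_lt.
Qed.

(** If an extremal edge comes after level [n], it makes the index forget how it
    was started above; otherwise the index 0 is kept all the way down. *)
Lemma idx_from0_stable a n : exists D, forall d, D <= d -> idx_from0 a n d = idx_from0 a n D.
Proof.
have [[m [nm em]]|no] := pselect (exists m, n < m /\ extremal (a m)); last first.
  have ne m : n < m -> ~~ extremal (a m).
    by move=> nm; apply/negP => em; apply: no; exists m.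
  exists 0 => d _ /=; elim: d n ne {no} => //= d IH n ne.
  rewrite IH => [|m /ltnW]; last exact: ne.
  case: (thick_or_thin M HB (ne n.+1 (ltnSn n))) => te.
    by rewrite att_thick.
  by rewrite att_thin.
suff H k p d : extremal (a (p.+1 + k)) -> k < d -> idx_from0 a p d = idx_from0 a p k.+1.
  exists (m - n.+1).+1 => d; apply: H.
  by rewrite subnKC.
elim: k p d => [|k IH] p [//|d] ep kd /=.
  have H e : att c (a p.+1) (idx_from0 a p.+1 e) = if emin (a p.+1) then 3 else 0.
    case: ifP => me; first by rewrite att_min //; exact: idx_from0_lt.
    rewrite addn0 in ep.
    by rewrite att_max //; [exact: idx_from0_lt|move: ep; rewrite /extremal me].
  exact: etrans (H d) (esym (H 0)).
by rewrite (IH p.+1) // addSn -addnS.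
Qed.

Lemma collapse_surj a : exists b, collapse c b = a.
Proof.
have [D DP] := choice (idx_from0_stable a).
have [n|n|b [ba _]] := @lift_exists _ c a (fun n => idx_from0 a n (D n)).
- exact: idx_from0_lt.
- rewrite -(DP n (maxn (D n) (D n.+1)).+1); last lia.
  by rewrite /= (DP n.+1) //; lia.
- by exists b.
Qed.

Lemma lift_unique_extremal b b' :
  collapse c b = collapse c b' ->
  (forall N, exists m, N <= m /\ extremal (collapse c b m)) -> b = b'.
Proof.
move=> ebb ext; apply: lift_unique => // n; apply/eqP; apply: contraT => /eqP nn.
have [m [nm]] := ext n.+1.
by rewrite (negbTE (fibre_nonextremal ebb nn nm)).
Qed.

(** The point is that every copied vertex emits an edge.  The fourth copy of
    [v0 n] is the source of all copies of minimal edges.  The copies 0, 1, 2 of [v] are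
    the sources of copies with index 3 of edges into [v0 n.+1]: those edges that come
    from [v] are attached cyclically, and there are at least four of them. *)
Lemma copy_bratteli : bratteli hB.
Proof.
have [card0 srcP rngP] := HB.1; split.
- have [v allv] := fintype1 card0.
  pose o := Ordinal (ncopies_gt0 v).
  rewrite -(card1 (Tagged (fun v : vtx B 0 => 'I_(ncopies c v)) o)).
  apply: eq_card => x; rewrite !inE; apply/esym/eqP/copy_vtx_eq.
    by rewrite (allv (tag x)).
  by have := ltn_ord (tagged x); rewrite [X in _ < X]ncopies0 /=; case: (nat_of_ord _).
- move=> n v.
  suff [e [j [je se ae]]] : exists (e : edg B n) (j : nat),
      [/\ j < ncopies c (rng e), src e = tag v & att c e j = tagged v].
    exists (Tagged (fun e : edg B n => 'I_(ncopies c (rng e))) (Ordinal je)).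
    by apply: copy_vtx_eq => //=; rewrite -att_ord.
  case: v => v i /=; case: n v i => [|n] v i.
    have [e se] := srcP _ v; exists e, 0; split=> //; first exact: ncopies_gt0.
    have := @att_lt _ c _ e 0 (ncopies_gt0 _); have := ltn_ord i.
    by have := ncopies0 c v; have := ncopies0 c (src e); rewrite /=; lia.
  have [i2|i3] := leqP i 2; last first.
    have /andP[_ i4] := ncopies_bounds v (ltn0Sn n).
    have vv : v = v0 n.+1.
      by apply/eqP; have := ltn_ord i; rewrite [X in _ < X]Hi //; case: ifP; lia.
    have [e [re me]] := emin_exists HB (v0 n.+2).
    exists e, 0; split; first exact: ncopies_gt0.
      have [/(_ me)[se _] _] := Hii (Ordinal (ncopies_gt0 (rng e))) (ltn0Sn n).
      exact: etrans se (esym vv).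
    by rewrite att_min //; [have := ltn_ord i; lia|exact: ncopies_gt0].
  have := Hc v (isT : 1 < n.+2); set S := [set e | _]%SET => S4.
  have SP : {in S, forall e, rng e = v0 n.+2} by move=> e; rewrite inE => /andP[_ /eqP].
  have ex k : k < 4 -> exists2 e, e \in S & #|[set f in S | elt f e]%SET| = k.
    by move=> k4; apply: (exists_rank_in HB SP); lia.
  have rk_le (e : edg B n.+1) : #|[set f in S | elt f e]%SET| <= erank e.
    by apply: subset_leq_card; apply/fintype.subsetP => f; rewrite !inE => /andP[].
  have rkE e : e \in S -> [set f in S | elt f e]%SET = [set f | elt f e && (src f == src e)]%SET.
    move=> eS; apply/setP => f; rewrite !inE andbC.
    case le : (elt f e) => //=; rewrite (elt_rng HB le) SP // eqxx andbT.
    by move: eS; rewrite inE => /andP[/eqP ->].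
  have fin k e : e \in S -> #|[set f in S | elt f e]%SET| = k -> 0 < k -> ~~ emax e ->
      exists (e : edg B n.+1) (j : nat),
        [/\ j < ncopies c (rng e), src e = v & att c e j = k %% 3].
    move=> eS ek k0 ne; have je : 3 < ncopies c (rng e) by rewrite Hi // SP // eqxx.
    exists e, 3; split=> //; first by move: eS; rewrite inE => /andP[/eqP].
    rewrite (att_ord (Ordinal je)) Hiii ?SP //.
      by rewrite -rkE // ek.
    rewrite (emax_rank HB) SP // in ne; have := erank_bound HB e.
    by rewrite SP //; have := rk_le e; lia.
  have nmax k e : e \in S -> #|[set f in S | elt f e]%SET| = k -> k < 3 -> ~~ emax e.
    move=> eS ek k3; have [f fS fk] := ex k.+1 k3.
    have nef : e != f by apply/eqP => ef; move: fk; rewrite -ef ek; lia.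
    have [|le|le] := elt_total HB _ nef; first by rewrite !SP.
      by apply/negP => /forallP /(_ f); rewrite le.
    suff : #|[set g in S | elt g f]%SET| <= #|[set g in S | elt g e]%SET| by lia.
    apply: subset_leq_card; apply/fintype.subsetP => g; rewrite !inE => /andP[-> lg] /=.
    exact: elt_trans le.
  (* Copy 0 needs the fourth edge, as the first one may be minimal; if the
     fourth is maximal, its source is copy 0 anyway. *)
  have [i0|i0] := posnP i.
    have [e eS ek] := ex 3 isT; have [me|/(fin _ _ eS ek isT)] := boolP (emax e).
      exists e, 0; split; [exact: ncopies_gt0|by move: eS; rewrite inE => /andP[/eqP]|].
      by rewrite att_max // ncopies_gt0.
    by rewrite i0.
  have [|e eS ek] := ex i; first lia.
  have := fin _ _ eS ek i0 (nmax _ _ eS ek i2).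
  by rewrite modn_small.
- move=> n [v j]; have [e re] := rngP _ v; subst v.
  by exists (Tagged (fun e : edg B n => 'I_(ncopies c (rng e))) j).
Qed.

Lemma copy_properly_ordered : properly_ordered hB.
Proof.
have [[p [mp up]] [q [mq uq]]] := Hp; split.
  have [b ba] := collapse_surj p; exists b; split; first by apply/pmax_collapse; rewrite ?ba.
  move=> b' /(pmax_collapse HB) /up ba'; apply: lift_unique_extremal; first by rewrite ba.
  by move=> N; exists N; split=> //; rewrite ba /extremal mp orbT.
have [b ba] := collapse_surj q; exists b; split; first by apply/(pmin_collapse HB); rewrite ba.
move=> b' /(pmin_collapse HB) /uq ba'; apply: lift_unique_extremal; first by rewrite ba.
by move=> N; exists N; split=> //; rewrite ba /extremal mq.
Qed.

Lemma copy_ordered : ordered_bratteli hB.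
Proof. by split; [exact: copy_bratteli|exact: copy_edge_order]. Qed.

(** The singleton fibre is the one over the minimal path. *)
Lemma collapse_almost_1to1 : almost_1to1 (collapse c).
Proof.
split.
  split; first exact: collapse_continuous.
    by move=> a _; have [b ba] := collapse_surj a; exists b.
  exact: (collapse_vershik HB Hp copy_ordered copy_properly_ordered).
have [_ [p [mp up]]] := copy_properly_ordered.
exists (collapse c p), p; apply/seteqP; split=> [b /= bp|_ -> //].
apply/esym/up/(pmin_collapse HB); rewrite bp.
by apply/(pmin_collapse HB).
Qed.

(** If [a] is eventually thick, the index of a lift is eventually constant, at
    most 2, and determines the lift; otherwise the fibre is a singleton. *)
Lemma fibre_card a : (collapse c @^-1` [set a] #<= `I_3)%card.
Proof.
have [h hinj] : exists2 h : XB hB -> nat,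
    forall b b', collapse c b = a -> collapse c b' = a -> h b = h b' -> b = b' &
    forall b, collapse c b = a -> h b < 3.
  have [[N HN]|no] := pselect (exists N, forall m, N <= m -> thick M (a m)).
    exists (fun b => idx b N) => [b b'|b ba].
      move=> ba ba' e; apply: lift_unique => [|n]; first by rewrite ba.
      have e' : idx b (maxn n N) = idx b' (maxn n N).
        have H (x : XB hB) m : collapse c x = a -> idx x (m + N) = idx x N.
          move=> xa; elim: m => [//|m IH].
          have te k : thick M (collapse c x (k + N).+1) by rewrite xa; apply: HN; lia.
          rewrite -IH [RHS]idx_step att_thick ?te //; apply: idx_le2.
          exact: (thick_nonextremal HB Hcol (ltn0Sn _) (te m.+1)).
        by rewrite -(subnK (leq_maxr n N)) !H.
      apply/eqP; apply: contraT => /eqP /(idx_neq_up (etrans ba (esym ba'))).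
      by move=> /(_ _ (leq_maxl n N)); rewrite e'.
    rewrite ltnS; apply: idx_le2; rewrite ba.
    by apply: (thick_nonextremal HB Hcol) => //; apply: HN; lia.
  exists (fun=> 0) => [b b'|//] ba ba' _.
  apply: lift_unique => [|n]; first by rewrite ba.
  apply/eqP; apply: contraT => /eqP nn; exfalso; apply: no.
  by have := fibre_thick (etrans ba (esym ba')) nn; rewrite ba.
move=> h3; rewrite -(card_le_eql (inj_card_eq (f := h) _)).
  by apply: subset_card_le => _ [b /h3 + <-].
by move=> b b' /set_mem ba /set_mem ba'; exact: hinj.
Qed.

(** If [m] is the level of the thin edge (0 if there is none), two lifts are given
    by the index 0 throughout, and by the index 2 from level [m] on and 1 below. *)
Lemma DsetP a : Dset c a <-> one_thin M a.
Proof.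
split=> [[b [b' [ba ba' n0]]]|[ne one]].
  have nn : idx b 0 <> idx b' 0.
    move=> e; apply: n0; apply: copy_edg_eq => //.
    exact: (congr1 (fun a : XB B => a 0) (etrans ba (esym ba'))).
  have ebb := etrans ba (esym ba'); split=> m; rewrite -ba.
    exact: fibre_nonextremal nn.
  by move=> m' m0 mm tm; apply/negP => /(fibre_one_thin ebb nn m0 mm tm).
have [m mP] : exists m, forall n, 0 < n -> thin M (a n) = (n == m).
  have [[m [m0 tm]]|no] := pselect (exists m, 0 < m /\ thin M (a m)).
    exists m => n n0; case: ltngtP => nm.
    - by apply/negP => tn; have := one _ _ n0 nm tn; rewrite tm.
    - exact: negbTE (one _ _ m0 nm tm).
    - by rewrite nm.
  exists 0 => n n0; rewrite gtn_eqF //; apply/negP => tn.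
  by apply: no; exists n.
have tk n : 0 < n -> n != m -> thick M (a n).
  by move=> n0 nm; apply: (thick_by_exclusion HB); [exact: ne|rewrite mP].
have [n|n|b [ba bj]] := @lift_exists _ c a (fun n => if m <= n then 2 else 1).
- by have /andP[+ _] := ncopies_bounds (rng (a n)) (ltn0Sn n); case: ifP; lia.
- have [nm|nm] := eqVneq n.+1 m.
    by rewrite -nm leqnn ltnn att_thin // mP // nm.
  rewrite att_thick ?tk //; last by case: ifP.
  by congr (if _ then _ else _); apply/idP/idP; lia.
have [n|n|b' [ba' bj']] := @lift_exists _ c a (fun n => 0).
- exact: ncopies_gt0.
- have [nm|nm] := eqVneq n.+1 m; last by rewrite att_thick ?tk.
  by rewrite att_thin // mP // nm.
exists b, b'; split=> // e0.
by have := bj 0; rewrite /idx e0 -/(idx b' 0) bj'; case: ifP.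
Qed.

(** * Expansiveness *)

Let HhB := copy_ordered.
Let HhP := copy_properly_ordered.

(** Moving [b] along its orbit changes finitely many levels; as the tail of the
    collapsed path beyond [n] is the same, so is the index at [n], and the thick edges
    below copy it down to level 0. *)
Lemma idx_transport (b : XB hB) z n :
  let a' := vershik_iter z (collapse c b) in
  (forall m, n < m -> a' m = collapse c b m) ->
  (forall m, n < m -> ~~ extremal (collapse c b m)) ->
  (forall m, 0 < m -> m <= n -> thick M (a' m)) ->
  idx (vershik_iter z b) 0 = idx b n.
Proof.
move=> a' tail ne tk; set y := vershik_iter z b.
have ya : collapse c y = a' by exact: collapse_vershik_iter.
have [N yN] : exists N, forall m, N <= m -> y m = b m.
  apply: (vershik_iter_tail HhB HhP); exists n.+1 => m /ne.
  by rewrite (extremal_copy HB).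
have yb d m : n <= m -> N <= m + d -> idx y m = idx b m.
  elim: d m => [|d IH] m nm Nm; first by rewrite /idx yN // -(addn0 m).
  by rewrite (idx_step y) (idx_step b) ya tail // IH //; lia.
rewrite -(yb N n) //; last lia.
have ney m : 0 < m -> ~~ extremal (collapse c y m).
  move=> m0; rewrite ya; have [mn|nm] := leqP m n.
    exact: (thick_nonextremal HB Hcol m0 (tk m m0 mn)).
  by rewrite tail // ne.
have y0 m : m <= n -> idx y 0 = idx y m.
  elim: m => [//|m IH] mn; rewrite IH ?(ltnW mn) // idx_step.
  rewrite att_thick //; last by rewrite ya; apply: tk.
  exact: (idx_le2 (ney _ (ltn0Sn _))).
exact: y0.
Qed.

Lemma copy_expansive k : expansive B k -> expansive hB k.
Proof.
move=> ex b b' nb; have [e|ne] := pselect (collapse c b = collapse c b'); last first.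
  have [z nz] := ex _ _ ne; exists z => sh; apply: nz => i ik.
  by rewrite -!(collapse_vershik_iter HB Hp HhB HhP) /= sh.
have [n nn] : exists n, idx b n <> idx b' n.
  by apply: contrapT => no; apply: nb; apply: lift_unique => // n;
     apply: contrapT => nn; apply: no; exists n.
have [a' [tail tk]] := thick_head HB Hcol n (collapse c b).
have [|z za] := same_orbit HB Hp (n := n.+1) (a := collapse c b) (b := a').
  by move=> i /tail.
exists z => /(_ 0 (leq0n k)) e0.
have ne m (nm : n < m) := fibre_nonextremal e nn nm.
have tr (x : XB hB) : collapse c x = collapse c b -> idx (vershik_iter z x) 0 = idx x n.
  by move=> xb; apply: idx_transport; rewrite xb ?za.
by apply: nn; rewrite -(tr b) // -(tr b') // /idx e0.
Qed.

End Extension.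

(** * Frequency of visits to D *)

Lemma sum_indic (R : realType) (B : diagram) (A : set (XB B)) t (a : XB B) :
  (\sum_(0 <= i < t) \1_A (iter i vershik a) =
   (\sum_(0 <= i < t) (iter i vershik a \in A))%N%:R :> R)%R.
Proof. by rewrite natr_sum; apply: eq_bigr => i _; rewrite indicE. Qed.

Section Density.
Variables (R : realType) (B : diagram) (v0 : forall n, vtx B n).
Variables (M : forall n, vtx B n.+1 -> nat).
Hypotheses (HB : ordered_bratteli B) (Hcol : coloured M).
Hypothesis Ha : forall n (e : edg B n), 1 <= n -> emin e -> src e = v0 n.
Hypothesis Hd : forall n (a : XB B) k, 1 <= n -> quite_small v0 n a -> 1 <= k ->
  (k%:R^-1 * #|[set i : 'I_k | ~~ thick M (iter i vershik a n)]%SET|%:R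
     < 3%:R ^- n :> R)%R.
Hypothesis He : forall n (a : XB B) t, 2 <= n -> 0 < t -> crosses_thin M n t a ->
  (t.+1%:R^-1 * \sum_(0 <= i < t.+1)
      \1_(Cstarstar M n.-1) (iter i vershik a) < 2%:R^-1 :> R)%R.
Implicit Types (a x y : XB B).

Lemma Cstarstar_freq n a t : 2 <= n -> 0 < t -> crosses_thin M n t a ->
  2 * \sum_(0 <= i < t.+1) (iter i vershik a \in Cstarstar M n.-1) < t.+1.
Proof.
move=> n2 t0 /(He n2 t0).
by rewrite sum_indic mulrC ltr_pdivrMr ?ltr0n // mulrC ltr_pdivlMr ?ltr0n //
           -natrM ltr_nat mulnC.
Qed.

Lemma not_thick_freq n a k : 1 <= n -> quite_small v0 n a ->
  3 ^ n * \sum_(0 <= i < k) ~~ thick M (iter i vershik a n) <= k.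
Proof.
case: k => [|k]; first by rewrite big_geq // muln0.
move=> n1 qa; have := Hd n1 qa (ltn0Sn k).
rewrite mulrC ltr_pdivrMr ?ltr0n // mulrC ltr_pdivlMr ?exprn_gt0 ?ltr0n //.
rewrite -natrX -natrM ltr_nat mulnC big_mkord => /ltnW; congr (_ * _ <= _).
by rewrite -sum1dep_card big_mkcond.
Qed.

Lemma not_Cstarstar n x : ~ Cstarstar M n x ->
  (forall i, 0 < i -> i <= n -> thick M (x i)) /\ ~~ extremal (x n.+1).
Proof.
move=> nC; have ne i : 0 < i -> i <= n -> ~ (thin M (x i) \/ extremal (x i)).
  by move=> i0 ni h; apply: nC; left; exists x => //; exists i; rewrite i0.
split=> [i i0 ni|]; last by apply/negP => h; apply: nC; right; exists x.
have := ne i i0 ni; case: (boolP (extremal (x i))) => [_ []|nx]; first by right.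
by move=> h; apply: (thick_by_exclusion HB) => //; apply/negP => h'; apply: h; left.
Qed.

(** A step that moves level [n] away from its minimal edge resets all lower
    levels to minimal edges, whose sources are the vertices [v0]. *)
Lemma quite_small_entry n y p : 0 < n -> succ_at p y (vershik y) ->
  emin (y n) -> ~~ emin (vershik y n) -> quite_small v0 n (vershik y).
Proof.
move=> n0 [H1 H2 H3 H4] my nmy.
have pn : p = n.
  case: (ltngtP p n) => // h; first by rewrite H4 // my in nmy.
  by have [_] := H1 _ h; rewrite (negbTE nmy).
subst p; split.
- move=> i i2; have [_ mi] := H1 i ltac:(lia); have [_ mi1] := H1 i.+1 ltac:(lia).
  by rewrite -path_edgeP (Ha _ mi1) //; split=> //; apply/eqP; rewrite -emin_rank.
- by have [_ mi] := H1 n.-1 ltac:(lia); apply/eqP; rewrite -emin_rank.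
- by rewrite H3; move: my; rewrite emin_rank => /eqP ->.
Qed.

Section Window.
Variables (a : XB B) (n0 : nat).
Hypotheses (n02 : 2 <= n0) (aD : one_thin M a).
Hypothesis thickA : forall m, n0 <= m -> thick M (a m).
Notation orb i := (iter i vershik a).

Lemma orbit_succ i : exists p, succ_at p (orb i) (orb i.+1).
Proof.
apply: (vershik_succ HB) => mx.
have [N HN] := orbit_tail HB i (ex_intro _ 1 aD.1).
have := aD.1 (maxn 1 N) (leq_maxl _ _).
by rewrite -HN ?leq_maxr // /extremal mx orbT.
Qed.

Lemma crosses_eventually n : n0 <= n ->
  exists T, forall t, T <= t -> crosses_thin M n t a.
Proof.
move=> nn; have ta := thickA nn.
have [T [mT aT]] := reach_max HB n.+1 a.
exists T => t Tt; exists (rng (a n)); split; first by move: ta; rewrite /thick.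
exists T; split; last by rewrite mT // -path_edgeP aT // path_edgeP.
rewrite Tt andbT lt0n; apply/eqP => T0; rewrite T0 /= in mT.
have := thick_nonextremal HB Hcol (_ : 0 < n) ta.
by rewrite /extremal mT // orbT => /(_ ltac:(lia)).
Qed.

Lemma crosses_bounded t : exists N, forall n, n0 <= n -> crosses_thin M n t a -> n <= N.
Proof.
have [f fP] := choice (fun i => orbit_tail HB i (ex_intro _ 1 aD.1)).
exists (\max_(i < t.+1) f i) => n nn [l [_ [i [it [_ mi]]]]].
rewrite leqNgt; apply/negP => fn.
have it1 : i < t.+1 by lia.
have fi := leq_bigmax (F := fun i : 'I_t.+1 => f i) (Ordinal it1).
rewrite fP in mi; last by apply: leq_trans (ltnW fn); exact: fi.
have := thick_nonextremal HB Hcol (_ : 0 < n) (thickA nn).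
by rewrite /extremal mi orbT => /(_ ltac:(lia)).
Qed.

(** While level [n] is not crossed its edge, thick at the start, only moves up
    within the thick and thin range, so no carry reaches the levels beyond. *)
Lemma uncrossed n t i : n0 <= n -> ~ crosses_thin M n t a -> i <= t ->
  [/\ forall m, n < m -> orb i m = a m, rng (orb i n) = rng (a n) &
      ~~ extremal (orb i n)].
Proof.
move=> nn nc; have ta := thickA nn; have n_gt0 : 0 < n by lia.
elim: i => [_|i IH it]; first by split=> //; apply: (thick_nonextremal HB Hcol).
have [H1 H2 H3] := IH (ltnW it).
have [p [K1 K2 K3 K4]] := orbit_succ i.
have pn : p <= n.
  rewrite leqNgt; apply/negP => np.
  by have [mx _] := K1 _ np; rewrite /extremal mx orbT in H3.
have r1 : rng (orb i.+1 n) = rng (a n).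
  move: pn; rewrite leq_eqVlt => /orP[/eqP pn|pn]; first by rewrite -pn K2 pn.
  by rewrite K4.
split=> //; first by move=> m nm; rewrite K4 ?H1 //; lia.
rewrite /extremal negb_or; apply/andP; split.
  move: pn; rewrite leq_eqVlt => /orP[/eqP pn|pn].
    by rewrite emin_rank; move: K3; rewrite pn => ->.
  by rewrite K4 //; move: H3; rewrite /extremal negb_or => /andP[].
apply/negP => mx; apply: nc; exists (rng (a n)); split.
  by move: ta; rewrite /thick.
by exists i.+1; split.
Qed.

(** The core estimate, for [n] crossed and [n.+1] not.  Each time up to [t] is
    either in [Cstarstar], or a visit to D, or has thin edges at both [n] and [n.+1]. *)
Lemma one_thin_window_freq n t : n0 <= n -> crosses_thin M n t a -> ~ crosses_thin M n.+1 t a ->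
  t.+1 <= 6 * \sum_(0 <= i < t.+1) `[< one_thin M (orb i) >].
Proof.
move=> nn cr ncr.
have t0 : 0 < t by case: cr => l [_ [t' [? _]]]; lia.
have unc := uncrossed (leqW nn) ncr.
pose Z i := [&& orb i \notin Cstarstar M n.-1, ~~ thick M (orb i n) & thin M (orb i n.+1)].
have S2 := Cstarstar_freq (leq_trans n02 nn) t0 cr.
have cover i : i <= t ->
    1 <= (orb i \in Cstarstar M n.-1) + `[< one_thin M (orb i) >] + Z i.
  move=> it; have [//|nC] := boolP (orb i \in Cstarstar M n.-1).
  have [//|nZ] := boolP (Z i); first by rewrite addn1.
  suff -> : `[< one_thin M (orb i) >] by [].
  have [U1 U2 U3] := unc i it.
  have /not_Cstarstar[th ne] : ~ Cstarstar M n.-1 (orb i) by move/mem_set; apply/negP.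
  rewrite prednK in ne; last lia.
  have big m : n.+1 < m -> thick M (orb i m) by move=> ?; rewrite U1 //; apply: thickA; lia.
  have small m : 0 < m -> m < n -> thick M (orb i m) by move=> ? ?; apply: th; lia.
  apply/asboolP; split=> [m m0|m m' m0 mm tm].
    case: (ltngtP m n) => [mn|nm|->//].
      exact: (thick_nonextremal HB Hcol m0 (small _ m0 mn)).
    move: nm; rewrite leq_eqVlt => /orP[/eqP <-//|nm].
    exact: (thick_nonextremal HB Hcol m0 (big _ nm)).
  apply/negP => tm'; move: nZ; rewrite /Z nC /=.
  have mn : n <= m.
    rewrite leqNgt; apply/negP => mn.
    exact: (not_thick_thin (small _ m0 mn) tm).
  have mn' : m' <= n.+1.
    rewrite leqNgt; apply/negP => mn'.
    exact: (not_thick_thin (big _ mn') tm').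
  have em : m = n by lia.
  have em' : m' = n.+1 by lia.
  subst m m'; rewrite tm' andbT => /negPn tk.
  exact: (not_thick_thin tk tm).
have SZ : 9 * \sum_(0 <= i < t.+1) Z i <= t.+1.
  pose P i := thin M (orb i n.+1) && ~~ emin (orb i n).
  have ZP i : Z i -> P i.
    move=> /and3P[nC _ tn]; rewrite /P tn /=.
    have /not_Cstarstar[_] : ~ Cstarstar M n.-1 (orb i) by move/mem_set; apply/negP.
    by rewrite prednK; [rewrite /extremal negb_or => /andP[]|lia].
  have [exP|noP] := pselect (exists i, P i); last first.
    rewrite big1 ?muln0 // => i _; case Zi : (Z i) => //.
    by case: noP; exists i; exact: ZP.
  (* At the first such time [s] the orbit enters a quite small head at level
     [n], and [Z] can hold only from then on. *)
  have [s Ps mins] := ex_minnP exP.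
  have s0 : 0 < s.
    rewrite lt0n; apply/eqP => s0; move: Ps; rewrite s0 => /andP[/= th _].
    exact: (not_thick_thin (thickA (leqW nn)) th).
  have qs : quite_small v0 n (orb s).
    have [p sp] := orbit_succ s.-1; have [K1 K2 K3 K4] := sp.
    rewrite prednK // in sp K1 K2 K3 K4; move/andP: Ps => [th nm].
    have vs : orb s = vershik (orb s.-1) by rewrite -iterS prednK.
    rewrite vs in sp nm *; apply: (quite_small_entry _ sp) => //; first lia.
    (* One time before [s], either level [n] was minimal, as wanted, or level
       [n.+1] has just moved, which would have reset level [n]. *)
    have : ~~ P s.-1 by apply/negP => /mins; lia.
    rewrite /P negb_and negbK => /orP[nth|//].
    exfalso; have np : p <= n.
      rewrite leqNgt; apply/negP => np; have [_] := K1 _ np.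
      by rewrite vs (negbTE nm).
    by move: th nth; rewrite K4 // => ->.
  have [st|ts] := leqP s t.+1; last first.
    rewrite big_nat big1 ?muln0 // => i /andP[_ it]; case Zi : (Z i) => //.
    by have := mins _ (ZP _ Zi); lia.
  have := not_thick_freq (t.+1 - s) (_ : 1 <= n) qs.
  move=> /(_ ltac:(lia)) nt.
  rewrite (@big_cat_nat _ _ _ s) //= [X in X + _]big_nat big1 ?add0n; last first.
    move=> i /andP[_ it]; case Zi : (Z i) => //.
    by have := mins _ (ZP _ Zi); lia.
  apply: leq_trans (leq_subr s t.+1); apply: leq_trans nt; apply: leq_mul.
    by rewrite -[9]/(3 ^ 2) leq_exp2l //; lia.
  rewrite -{1}[s]add0n big_addn; apply: leq_sum => i _.
  by rewrite -iterD /Z; case: thick; rewrite /= ?andbF ?leq_b1.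
(* The visits to D have proportion at least 1 - 1/2 - 1/9 = 7/18 > 1/6. *)
have : \sum_(0 <= i < t.+1) 1 <=
   \sum_(0 <= i < t.+1) ((orb i \in Cstarstar M n.-1) + `[< one_thin M (orb i) >] + Z i).
  by rewrite !big_nat; apply: leq_sum => i /andP[_ it]; exact: cover.
rewrite !big_split /= sum_nat_const_nat subn0 muln1.
lia.
Qed.

End Window.

(** The first level where [a] is thick for good is eventually crossed, and only
    finitely many levels are crossed before a given time, so there is a last one. *)
Lemma one_thin_freq a : one_thin M a -> exists T, forall t, T <= t ->
  t <= 6 * \sum_(0 <= i < t) `[< one_thin M (iter i vershik a) >].
Proof.
move=> aD.
have [n0 n02 thickA] : exists2 n0, 2 <= n0 & forall m, n0 <= m -> thick M (a m).
  have [[m [m0 tm]]|no] := pselect (exists m, 0 < m /\ thin M (a m)).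
    exists (m + 2) => [|m' mm]; first lia.
    apply: (thick_by_exclusion HB); first by apply: aD.1; lia.
    by apply: (aD.2 m) => //; lia.
  exists 2 => // m m2; apply: (thick_by_exclusion HB); first by apply: aD.1; lia.
  by apply/negP => tm; apply: no; exists m; split=> //; lia.
have [T crT] := crosses_eventually n02 thickA (leqnn n0).
exists T.+1 => -[//|t]; rewrite ltnS => Tt.
have ex : exists n, (n0 <= n) && `[< crosses_thin M n t a >].
  by exists n0; rewrite leqnn; apply/asboolP/crT.
have [N HN] := crosses_bounded n02 aD thickA t.
have ub n : (n0 <= n) && `[< crosses_thin M n t a >] -> n <= N.
  by move=> /andP[nn /asboolP]; exact: HN.
have [n /andP[nn /asboolP cr] mx] := ex_maxnP ex ub.
apply: (one_thin_window_freq n02 aD thickA nn cr) => cr'.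
by have := mx n.+1; rewrite (leqW nn) ltnn => /(_ (asboolT cr')).
Qed.

End Density.

(** * The Birkhoff spectrum *)

Section Spectrum.
Variables (R : realType) (B : diagram) (c : copying B).
Implicit Types (a : XB B).
Notation orb a i := (iter i vershik a).
Notation SD := (birkhoff_spectrum c R).

Lemma birkhoff_meanE n a : birkhoff_mean c R n a =
  (n%:R^-1 * (\sum_(0 <= i < n) (orb a i \in Dset c))%N%:R)%R.
Proof. by rewrite /birkhoff_mean sum_indic. Qed.

Lemma birkhoff_mean_ge0 n a : (0 <= birkhoff_mean c R n a)%R.
Proof. by rewrite birkhoff_meanE mulr_ge0 ?invr_ge0 ?ler0n. Qed.

Lemma birkhoff_mean_le1 n a : (birkhoff_mean c R n a <= 1)%R.
Proof.
rewrite birkhoff_meanE; case: n => [|n]; first by rewrite big_geq // mulr0.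
rewrite mulrC ler_pdivrMr ?ltr0n // mul1r ler_nat.
apply: leq_trans (_ : \sum_(0 <= i < n.+1) 1 <= _).
  by apply: leq_sum => i _; case: (_ \in _).
by rewrite sum_nat_const_nat subn0 muln1.
Qed.

Lemma spectrum0 a : (forall i, ~ Dset c (orb a i)) -> SD 0%R.
Proof.
move=> nD; exists a => // N _; apply: subset_closure; exists N => /=; first exact: leqnn.
rewrite birkhoff_meanE big1 ?mulr0 // => i _.
by rewrite memNset.
Qed.

Lemma mean_cluster a (r : R) : (exists N, forall n, N <= n -> (r <= birkhoff_mean c R n a)%R) ->
  exists2 x, SD x & (r <= x)%R.
Proof.
move=> [N0 HN].
have cpt := @segment_compact R 0%R 1%R.
have [|x [_ clu]] := cpt ((fun n => birkhoff_mean c R n a) @ \oo) _.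
  by exists 0 => // n _ /=; rewrite in_itv /= birkhoff_mean_ge0 birkhoff_mean_le1.
exists x.
  exists a => // N _ V xV; apply: clu xV.
  by exists N => // n /= Nn; exists n.
have : closure [set y : R | (r <= y)%R] x.
  by move=> V xV; apply: clu xV; exists N0 => // n /= /HN.
by rewrite -(closure_id _).1 //; exact: closed_ge.
Qed.

Hypothesis freq : forall a, Dset c a -> exists T, forall t, T <= t ->
  t <= 6 * \sum_(0 <= i < t) (orb a i \in Dset c).

(** Half of the bound 1/6 is kept, to absorb the time before the orbit enters
    D. *)
Lemma mean_eventually_ge a i0 : Dset c (orb a i0) ->
  exists N, forall n, N <= n -> (12%:R^-1 <= birkhoff_mean c R n a)%R.
Proof.
move=> /freq[T HT]; exists ((i0 + T).+1 * 2) => n Nn.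
have n0 : 0 < n by lia.
rewrite birkhoff_meanE mulrC ler_pdivlMr ?ltr0n //.
rewrite mulrC ler_pdivrMr ?ltr0n // -natrM ler_nat mulnC.
have {}HT := HT (n - i0) ltac:(lia).
apply: leq_trans (_ : 2 * (n - i0) <= _); first lia.
rewrite (_ : 12 = 2 * 6) // -mulnA leq_mul2l /=; apply: leq_trans HT _.
rewrite leq_mul2l /= [leqRHS](@big_cat_nat _ _ _ i0) //=; last lia.
apply: leq_trans (leq_addl _ _).
rewrite -{3}[i0]add0n big_addn; apply: leq_sum => i _.
by rewrite -iterD.
Qed.

Lemma spectrum_gap x : SD x -> x = 0%R \/ (12%:R^-1 <= x)%R.
Proof.
move=> [a _ xcl].
have [[i0 /mean_eventually_ge[N HN]]|no] := pselect (exists i0, Dset c (orb a i0)).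
  right; have : closure [set y : R | (12%:R^-1 <= y)%R] x.
    by apply: closureS (xcl N I) => _ [n /= Nn <-]; exact: HN.
  by rewrite -(closure_id _).1 //; exact: closed_ge.
left; have : closure [set 0%R : R] x.
  apply: closureS (xcl 0 I) => _ [n _ <-] /=.
  rewrite birkhoff_meanE big1 ?mulr0 // => i _; rewrite memNset // => D.
  by apply: no; exists i.
by rewrite -(closure_id _).1 //; exact: closed_eq.
Qed.

Lemma spectrum_isolated0 a b : (forall i, ~ Dset c (orb a i)) -> Dset c b ->
  [/\ isolated SD 0%R, SD <> [set 0%R] & ~ is_interval SD].
Proof.
move=> /spectrum0 S0 Db.
have r0 : (0 < 12%:R^-1 :> R)%R by rewrite invr_gt0 ltr0n.
have [x Sx rx] := mean_cluster (mean_eventually_ge (i0 := 0) Db).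
split.
- split; first exact/mem_set.
  exists [set y : R | (y < 12%:R^-1)%R].
    by apply: open_nbhs_nbhs; split; [exact: open_lt|].
  apply/seteqP; split=> [y [/= yr /spectrum_gap[//|]]|_ -> //].
  by rewrite leNgt yr.
- move=> E; move: Sx rx; rewrite E => ->.
  by rewrite leNgt r0.
- move=> itv; have : SD (12%:R^-1 / 2%:R)%R.
    apply: itv S0 Sx _ _; rewrite divr_ge0 ?(ltW r0) ?ler0n //=.
    apply: le_trans rx; rewrite ler_pdivrMr ?ltr0n //.
    by rewrite ler_peMr ?(ltW r0) // ler1n.
  move=> /spectrum_gap[/eqP|]; first by rewrite mulf_eq0 !invr_eq0 !pnatr_eq0.
  by rewrite leNgt ltr_pdivrMr ?ltr0n // ltr_pMr // ltr1n.
Qed.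

End Spectrum.

(** * The theorem *)

Theorem theorem5p2 (R : realType) (B : diagram)
  (v0 : forall n, vtx B n) (M : forall n, vtx B n.+1 -> nat)
  (c : copying B)
  (HB : ordered_bratteli B) (Hsimple : simple B)
  (Hproper : properly_ordered B) (Hcantor : cantor_set B)
  (Hcol : coloured M)
  (Ha : forall n (e : edg B n), 1 <= n -> emin e -> src e = v0 n)
  (Hb : forall n (v : vtx B n.+1), 2 <= n.+1 -> 5 <= nedges v)
  (Hc : forall n (v : vtx B n), 2 <= n.+1 ->
     4 <= #|[set e : edg B n | (src e == v) && (rng e == v0 n.+1)]%SET|)
  (Hd : forall n (a : XB B) k, 1 <= n -> quite_small v0 n a -> 1 <= k ->
     (k%:R^-1 * #|[set i : 'I_k | ~~ thick M (iter i vershik a n)]%SET|%:R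
        < 3%:R ^- n :> R)%R)
  (He : forall n (a : XB B) t, 2 <= n -> 0 < t -> crosses_thin M n t a ->
     (t.+1%:R^-1 * \sum_(0 <= i < t.+1)
         \1_(Cstarstar M n.-1) (iter i vershik a) < 2%:R^-1 :> R)%R)
  (Hi : forall n (v : vtx B n), 1 <= n ->
     ncopies c v = if v == v0 n then 4 else 3)
  (Hii : forall n (e : edg B n) (j : 'I_(ncopies c (rng e))), 1 <= n ->
     (emin e -> src e = v0 n /\ attach j = 3 :> nat) /\
     (emax e -> attach j = 0 :> nat))
  (Hiii : forall n (e : edg B n) (j : 'I_(ncopies c (rng e))), 1 <= n ->
     rng e = v0 n.+1 -> j = 3 :> nat -> 1 <= erank e <= nedges (rng e) - 2 ->
     attach j = #|[set e' | elt e' e && (src e' == src e)]%SET| %% 3 :> nat)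
  (Hiv : forall n (e : edg B n) (j : 'I_(ncopies c (rng e))), 1 <= n ->
     (thick M e -> j <= 2 -> attach j = j :> nat) /\
     (thin M e -> (j = 0 :> nat \/ j = 1 :> nat -> attach j = 0 :> nat) /\
                  (j = 2 :> nat -> attach j = 1 :> nat))) :
  let hB := copy_paste c in
  let SD := birkhoff_spectrum c R in
  [/\ ordered_bratteli hB /\ properly_ordered hB,
      almost_1to1 (collapse c),
      forall a : XB B, (collapse c @^-1` [set a] #<= `I_3)%card,
      [/\ isolated SD 0%R, SD <> [set 0%R] & ~ is_interval SD] &
      forall k, expansive B k -> expansive hB k].
Proof.
split.
- split; first exact: (copy_ordered HB Hc Hi Hii Hiii).
  exact: (copy_properly_ordered HB Hproper Hi Hii Hiv).
- exact: (collapse_almost_1to1 HB Hproper Hc Hi Hii Hiii Hiv).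
- exact: (fibre_card HB Hcol Hi Hii Hiii Hiv).
- have [_ [q [mq _]]] := Hproper.
  have DP := DsetP HB Hi Hii Hiii Hiv.
  have [b tb] := thick_path HB Hcol Hcantor q.
  apply: (@spectrum_isolated0 _ _ _ _ q b).
  + move=> a /DP Da.
    have [T HT] := one_thin_freq HB Hcol Ha Hd He Da.
    exists T => t /HT; congr (_ <= _ * _); apply: eq_bigr => i _.
    by congr nat_of_bool; apply: asbool_equiv_eq; apply: iff_sym; exact: DP.
  + move=> i /DP[ne _].
    have [|N HN] := orbit_extremal HB Hproper (a := q) i.
      by exists 0 => m _; rewrite /extremal mq.
    by have := ne (maxn 1 N) (leq_maxl _ _); rewrite HN ?leq_maxr.
  + apply/DP; split=> [m m0|m m' m0 _ tm].
      exact: (thick_nonextremal HB Hcol m0 (tb m m0)).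
    by case: (not_thick_thin (tb m m0) tm).
- exact: (copy_expansive HB Hproper Hcol Hc Hi Hii Hiii Hiv).
Qed.
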